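(* Let $\mathcal{L}$ be DLR or HAR. Let $\varphi\le\psi$ be an $\mathcal{L}$-inequality on which $\mathsf{ALBA}^r$ succeeds, and let $\mathsf{ALBA}^r(\varphi\le\psi)$ be the set of pure quasi-inequalities returned by a successful run. Then for every perfect $\mathcal{L}$-algebra $\mathbb{A}$, $\mathbb{A}\models\varphi\le\psi$ if and only if $\mathbb{A}\models\mathsf{ALBA}^r(\varphi\le\psi)$.
   Context: BDL means bounded distributive lattice. $A^\partial$ is the order dual of $A$, $A^1=A$, and $A^\epsilon=\prod_iA^{\epsilon_i}$ for an order type $\epsilon\in\{1,\partial\}^n$. $J^\infty(A)$, $M^\infty(A)$ are the sets of completely join-irreducible, respectively completely meet-irreducible, elements. Algebras. Fix $\eta_f,\eta_g\in\{1,\partial\}$, $\epsilon_k\in\{1,\partial\}^m$, $\epsilon_l\in\{1,\partial\}^n$. A DLR is $(A,f,g,k,l)$ with $A$ a BDL, $f:A^{\eta_f}\to A$ preserving finite nonempty joins, $g:A^{\eta_g}\to A$ preserving finite nonempty meets, $k:A^{\epsilon_k}\to A$ preserving finite nonempty joins in each coordinate, and $l:A^{\epsilon_l}\to A$ preserving finite nonempty meets in each coordinate. A HAR is a DLR whose lattice is a Heyting algebra, with $\to$ as an additional basic operation. Such an algebra is perfect if $A$ is complete, completely distributive, completely join-generated by $J^\infty(A)$ and completely meet-generated by $M^\infty(A)$, and $f,k$ (resp. $g,l$) preserve arbitrary nonempty joins (resp. meets) in each coordinate. $\mathcal{L}$-terms are built from propositional variables, $\top,\bot,\wedge,\vee,f,g,k,l$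 and, for HAR, $\to$. Expanded language $\mathcal{L}^+$. It adds nominals $\mathbf{i},\mathbf{j},\dots$ (ranging over $J^\infty(\mathbb{A})$), conominals $\mathbf{m},\mathbf{n},\dots$ (ranging over $M^\infty(\mathbb{A})$), the Heyting implication $\to$, its dual $-$ ($a-b\le c$ iff $a\le b\vee c$), and $\blacksquare_f$ if $\eta_f=1$ or $\blacktriangleleft_f$ if $\eta_f=\partial$, and $\text{◆}_g$ if $\eta_g=1$ or $\blacktriangleright_g$ if $\eta_g=\partial$. On a perfect algebra these are interpreted as follows. If $\eta_f=1$: $\Diamond_fu=\bigvee\{j\in J^\infty: j\le f(i)\text{ for some }i\in J^\infty, i\le u\}$, and $\Diamond_fu\le v$ iff $u\le\blacksquare_fv$. If $\eta_f=\partial$: $\lhd_fu=\bigvee\{j\in J^\infty: j\le f(m)\text{ for some }m\in M^\infty, u\le m\}$, and $\lhd_fu\le v$ iff $\blacktriangleleft_fv\le u$. If $\eta_g=1$: $\Box_gu=\bigwedge\{n\in M^\infty: g(m)\le n\text{ for some }m\in M^\infty, u\le m\}$, and $\text{◆}_gv\le u$ iff $v\le\Box_gu$. If $\eta_g=\partial$: $\rhd_gu=\bigwedge\{n\in M^\infty: g(i)\le n\text{ for some }i\in J^\infty, i\le u\}$, and $v\le\rhd_gu$ iff $u\le\blacktriangleright_gv$. A quasi-inequality is $(\varphi_1\le\psi_1\,\&\cdots\&\,\varphi_n\le\psi_n)\Rightarrow\varphi\le\psi$; it is pure if it has no propositional variables. Validity means truth under all assignments (variables to elements, nominals to $J^\infty$,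 conominals to $M^\infty$). Signed generation tree $\pm s$: sign the root $\pm$, keep the sign at children in monotone coordinates and switch it at children in antitone coordinates. SAC nodes: $+\vee,+\wedge,+f,+k,-\wedge,-\vee,-g,-l$, and also $-\to$ for HAR. The algorithm $\mathsf{ALBA}^r$ on input $\varphi\le\psi$. Stage 1 (preprocessing). Exhaustively apply to the signed generation trees $+\varphi$, $-\psi$ the following steps. (1) (a) Push down, towards variables, occurrences of $+\wedge$, $+f$ (if $\eta_f=1$), $-g$ (if $\eta_g=\partial$), $+k$ (for $\epsilon_k(i)=1$), $-l$ (for $\epsilon_l(i)=\partial$), by distributing them over nodes labelled with $+\vee$ (in the $i$-th coordinate for $k,l$) which are SAC nodes; (b) push down, towards variables, occurrences of $-\vee$, $-g$ (if $\eta_g=1$), $+f$ (if $\eta_f=\partial$), $+k$ (for $\epsilon_k(i)=\partial$), $-l$ (for $\epsilon_l(i)=1$), by distributing them over nodes labelled with $-\wedge$ (in the $i$-th coordinate for $k,l$) which are SAC nodes. (2) Splitting: replace $\alpha\le\beta\wedge\gamma$ by $\alpha\le\beta,\ \alpha\le\gamma$; replace $\alpha\vee\beta\le\gamma$ by $\alpha\le\gamma,\ \beta\le\gamma$. (3) Variable elimination: for $\beta(p)$ positive and $\alpha(p)$ negative in $p$, replace $\alpha(p)\le\beta(p)$ by $\alpha(\bot)\le\beta(\bot)$, and $\beta(p)\le\alpha(p)$ by $\beta(\top)\le\alpha(\top)$. The result is a finite set $\mathsf{Preprocess}(\varphi\le\psi)$. To each member $\varphi_i\le\psi_i$ apply once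 the first approximation rule, producing the initial system $\{\mathbf{i}_0\le\varphi_i,\ \psi_i\le\mathbf{m}_0\}$. Stage 2 (reduction). Transform systems with the following rules (all nominals and conominals introduced must be fresh; each alternative produced yields a separate system). Splitting: replace $\alpha\le\beta\wedge\gamma$ by $\alpha\le\beta,\ \alpha\le\gamma$; replace $\alpha\vee\beta\le\gamma$ by $\alpha\le\gamma,\ \beta\le\gamma$. Residuation: from $\phi\wedge\psi\le\chi$ to $\psi\le\phi\to\chi$ (for HAR also in the converse direction); from $\phi\le\psi\vee\chi$ to $\phi-\chi\le\psi$. Adjunction: $f(\phi)\le\psi$ is replaced by $f(\bot)\le\psi,\ \phi\le\blacksquare_f\psi$ if $\eta_f=1$, and by $f(\top)\le\psi,\ \blacktriangleleft_f\psi\le\phi$ if $\eta_f=\partial$; $\phi\le g(\psi)$ is replaced by $\phi\le g(\top),\ \text{◆}_g\phi\le\psi$ if $\eta_g=1$, and by $\phi\le g(\bot),\ \psi\le\blacktriangleright_g\phi$ if $\eta_g=\partial$. (The first inequality of each pair is called the side condition.) Approximation: $\mathbf{i}\le f(\phi)$ is replaced by the alternatives $[\mathbf{i}\le f(\bot)]$ or $[\mathbf{j}\le\phi,\ \mathbf{i}\le f(\mathbf{j})]$ if $\eta_f=1$, and $[\mathbf{i}\le f(\top)]$ or $[\phi\le\mathbf{m},\ \mathbf{i}\le f(\mathbf{m})]$ if $\eta_f=\partial$; $g(\psi)\le\mathbf{m}$ is replaced by $[g(\top)\le\mathbf{m}]$ or $[\psi\le\mathbf{n},\ g(\mathbf{n})\le\mathbf{m}]$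 if $\eta_g=1$, and $[g(\bot)\le\mathbf{m}]$ or $[\mathbf{i}\le\psi,\ g(\mathbf{i})\le\mathbf{m}]$ if $\eta_g=\partial$. Writing $\epsilon^+,\epsilon^-$ for the sets of coordinates of order type $1$, $\partial$: $\mathbf{i}\le k(\overline\phi_{\epsilon_k^+},\overline\psi_{\epsilon_k^-})$ is replaced by the alternatives, one for each $P\subseteq\epsilon_k^+$, $N\subseteq\epsilon_k^-$, consisting of $\mathbf{i}\le k(\overline{\mathbf{j}}_P,\overline\bot_{\epsilon_k^+\setminus P},\overline{\mathbf{m}}_N,\overline\top_{\epsilon_k^-\setminus N})$, $\mathbf{j}_e\le\phi_e$ ($e\in P$), $\psi_e\le\mathbf{m}_e$ ($e\in N$); and $l(\overline\phi_{\epsilon_l^+},\overline\psi_{\epsilon_l^-})\le\mathbf{m}$ by the alternatives, one for each $P\subseteq\epsilon_l^+$, $N\subseteq\epsilon_l^-$, consisting of $l(\overline{\mathbf{n}}_P,\overline\top_{\epsilon_l^+\setminus P},\overline{\mathbf{i}}_N,\overline\bot_{\epsilon_l^-\setminus N})\le\mathbf{m}$, $\phi_e\le\mathbf{n}_e$ ($e\in P$), $\mathbf{i}_e\le\psi_e$ ($e\in N$). For HAR only: $\phi\to\chi\le\mathbf{m}$ is replaced by $\mathbf{j}\le\phi,\ \chi\le\mathbf{n},\ \mathbf{j}\to\mathbf{n}\le\mathbf{m}$. Ackermann rules (applied to a whole system): the right rule replaces $\{\alpha_i\le p\}_{i=1}^n\cup\{\beta_j(p)\le\gamma_j(p)\}_{j=1}^{r}$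 by $\{\beta_j(\bigvee_i\alpha_i)\le\gamma_j(\bigvee_i\alpha_i)\}_j$, where $p$ does not occur in the $\alpha_i$, the $\beta_j$ are positive and the $\gamma_j$ negative in $p$; the left rule replaces $\{p\le\alpha_i\}_{i=1}^n\cup\{\beta_j(p)\le\gamma_j(p)\}_{j=1}^r$ by $\{\beta_j(\bigwedge_i\alpha_i)\le\gamma_j(\bigwedge_i\alpha_i)\}_j$, where $p$ does not occur in the $\alpha_i$, the $\beta_j$ are negative and the $\gamma_j$ positive in $p$ (empty joins and meets are $\bot$, $\top$; inequalities without $p$ are unaffected). Stage 3 (output). The run succeeds if all propositional variables have been eliminated from all systems; an inequality on which some run succeeds is called an $\mathsf{ALBA}^r$-inequality. The output $\mathsf{ALBA}^r(\varphi\le\psi)$ is the set of all pure quasi-inequalities $\&[S]\Rightarrow\mathbf{i}_0\le\mathbf{m}_0$, where $S$ ranges over the final systems obtained from the initial systems (the alternatives produced by approximation rules giving one quasi-inequality each). *)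

(* Defs.v *)
From Stdlib Require List Relations.
From mathcomp Require Import all_boot all_order.
From mathcomp Require Import boolp classical_sets.

Set Implicit Arguments.
Unset Strict Implicit.
Unset Printing Implicit Defensive.

Local Open Scope classical_set_scope.
Local Open Scope order_scope.

Variant otype := One | Dual.

Record signature := Signature {
  eta_f : otype;
  eta_g : otype;
  ar_k : nat;
  ar_l : nat;
  eps_k : 'I_ar_k -> otype;
  eps_l : 'I_ar_l -> otype
}.

Variant logic := DLR | HAR.

Section DualOperations.
Context {d : Order.disp_t} {A : tbDistrLatticeType d}.

(* Joins and meets of A^o, as operations on A. *)
Definition ojoin (o : otype) (a b : A) : A :=
  if o is One then a `|` b else a `&` b.
Definition omeet (o : otype) (a b : A) : A :=
  if o is One then a `&` b else a `|` b.
Definition osups (o : otype) (S : set A) : set A :=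
  if o is One then supremums S else infimums S.
Definition oinfs (o : otype) (S : set A) : set A :=
  if o is One then infimums S else supremums S.

End DualOperations.

Definition upd {n : nat} {T : Type} (x : 'I_n -> T) (i : 'I_n) (a : T) :
    'I_n -> T :=
  fun j => if j == i then a else x j.

Record dlr (sg : signature) {d : Order.disp_t} (A : tbDistrLatticeType d) := {
  op_f : A -> A;
  op_g : A -> A;
  op_k : ('I_(ar_k sg) -> A) -> A;
  op_l : ('I_(ar_l sg) -> A) -> A;
  op_f_join : forall a b,
    op_f (ojoin (eta_f sg) a b) = op_f a `|` op_f b;
  op_g_meet : forall a b,
    op_g (omeet (eta_g sg) a b) = op_g a `&` op_g b;
  op_k_join : forall x i a b,
    op_k (upd x i (ojoin (eps_k i) a b)) =
      op_k (upd x i a) `|` op_k (upd x i b);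
  op_l_meet : forall x i a b,
    op_l (upd x i (omeet (eps_l i) a b)) =
      op_l (upd x i a) `&` op_l (upd x i b)
}.

Record har (sg : signature) {d : Order.disp_t} (A : tbDistrLatticeType d) := {
  har_dlr : dlr sg A;
  op_imp : A -> A -> A;
  op_impP : forall a b c, (c <= op_imp a b) = (a `&` c <= b)
}.

Definition algebra (L : logic) (sg : signature) {d : Order.disp_t}
    (A : tbDistrLatticeType d) : Type :=
  match L with DLR => dlr sg A | HAR => har sg A end.

Definition dlr_of {L : logic} {sg : signature} {d : Order.disp_t}
    {A : tbDistrLatticeType d} : algebra L sg A -> dlr sg A :=
  match L with DLR => id | HAR => @har_dlr sg d A end.

Section Perfect.
Context {d : Order.disp_t} (A : tbDistrLatticeType d).

Definition Jinf : set A := [set j | forall S : set A, supremums S j -> S j].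
Definition Minf : set A := [set m | forall S : set A, infimums S m -> S m].

(* In a complete lattice these are the join and the meet of S. *)
Definition bigsup (S : set A) : A := supremum \bot S.
Definition biginf (S : set A) : A := infimum \top S.

Record perfect_lattice : Prop := {
  perfect_sup : forall S : set A, supremums S !=set0;
  perfect_inf : forall S : set A, infimums S !=set0;
  perfect_distributive :
    forall (I : Type) (K : I -> Type) (x : forall i, K i -> A),
      biginf (range (fun i => bigsup (range (x i)))) =
      bigsup (range (fun c : forall i, K i =>
                       biginf (range (fun i => x i (c i)))));
  perfect_join_generated :
    forall a, exists2 S : set A, S `<=` Jinf & supremums S a;
  perfect_meet_generated :
    forall a, exists2 S : set A, S `<=` Minf & infimums S a
}.

End Perfect.

Arguments Jinf {d A}.
Arguments Minf {d A}.

Record perfect {L : logic} {sg : signature} {d : Order.disp_t}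
    {A : tbDistrLatticeType d} (X : algebra L sg A) : Prop := {
  perfectL : perfect_lattice A;
  perfect_f : forall (S : set A) s,
    S !=set0 -> osups (eta_f sg) S s ->
    supremums (op_f (dlr_of X) @` S) (op_f (dlr_of X) s);
  perfect_g : forall (S : set A) s,
    S !=set0 -> oinfs (eta_g sg) S s ->
    infimums (op_g (dlr_of X) @` S) (op_g (dlr_of X) s);
  perfect_k : forall x i (S : set A) s,
    S !=set0 -> osups (eps_k i) S s ->
    supremums ((fun a => op_k (dlr_of X) (upd x i a)) @` S)
              (op_k (dlr_of X) (upd x i s));
  perfect_l : forall x i (S : set A) s,
    S !=set0 -> oinfs (eps_l i) S s ->
    infimums ((fun a => op_l (dlr_of X) (upd x i a)) @` S)
             (op_l (dlr_of X) (upd x i s))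
}.

Variant atom := PVar of nat | Nominal of nat | Conominal of nat.

(* [tAdjF] is the connective adjoint to f: black box if [eta_f = One], black
   left triangle if [eta_f = Dual].  [tAdjG] is the connective adjoint to g:
   black diamond if [eta_g = One], black right triangle if [eta_g = Dual].
   [tSub] is the dual implication, written as a subtraction. *)
Inductive term (sg : signature) : Type :=
| tAtom of atom
| tTop
| tBot
| tAnd of term sg & term sg
| tOr of term sg & term sg
| tF of term sg
| tG of term sg
| tK of ('I_(ar_k sg) -> term sg)
| tL of ('I_(ar_l sg) -> term sg)
| tImp of term sg & term sg
| tSub of term sg & term sg
| tAdjF of term sg
| tAdjG of term sg.

Arguments tAtom {sg} _.
Arguments tTop {sg}.
Arguments tBot {sg}.

Notation tVar p := (tAtom (PVar p)).
Notation tNom i := (tAtom (Nominal i)).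
Notation tCon m := (tAtom (Conominal m)).

Fixpoint Lterm (L : logic) {sg : signature} (t : term sg) : Prop :=
  match t with
  | tAtom x => if x is PVar _ then True else False
  | tTop | tBot => True
  | tAnd a b | tOr a b => Lterm L a /\ Lterm L b
  | tF a | tG a => Lterm L a
  | tK ts => forall i, Lterm L (ts i)
  | tL ts => forall i, Lterm L (ts i)
  | tImp a b => L = HAR /\ Lterm L a /\ Lterm L b
  | tSub _ _ | tAdjF _ | tAdjG _ => False
  end.

Fixpoint subst {sg : signature} (p : nat) (u t : term sg) : term sg :=
  match t with
  | tAtom x => if x is PVar q then if q == p then u else tVar q else tAtom x
  | tTop => tTop
  | tBot => tBot
  | tAnd a b => tAnd (subst p u a) (subst p u b)
  | tOr a b => tOr (subst p u a) (subst p u b)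
  | tF a => tF (subst p u a)
  | tG a => tG (subst p u a)
  | tK ts => tK (fun i => subst p u (ts i))
  | tL ts => tL (fun i => subst p u (ts i))
  | tImp a b => tImp (subst p u a) (subst p u b)
  | tSub a b => tSub (subst p u a) (subst p u b)
  | tAdjF a => tAdjF (subst p u a)
  | tAdjG a => tAdjG (subst p u a)
  end.

Fixpoint bigOr {sg : signature} (s : seq (term sg)) : term sg :=
  match s with
  | [::] => tBot
  | [:: a] => a
  | a :: s' => tOr a (bigOr s')
  end.

Fixpoint bigAnd {sg : signature} (s : seq (term sg)) : term sg :=
  match s with
  | [::] => tTop
  | [:: a] => a
  | a :: s' => tAnd a (bigAnd s')
  end.

Variant sign := Plus | Minus.

Definition flip (s : sign) : sign := if s is Plus then Minus else Plus.

(* The sign of a child at a coordinate of order type [o] of a node signed [s]. *)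
Definition child_sign (o : otype) (s : sign) : sign :=
  if o is One then s else flip s.

(* [signed_occ r x s t]: in the generation tree of [t] whose root is signed [s],
   some leaf labelled [x] is signed [r].  Both adjoints are monotone (antitone)
   exactly when the operation they come from is. *)
Fixpoint signed_occ {sg : signature} (r : sign) (x : atom) (s : sign)
    (t : term sg) : Prop :=
  match t with
  | tAtom y => y = x /\ s = r
  | tTop | tBot => False
  | tAnd a b | tOr a b => signed_occ r x s a \/ signed_occ r x s b
  | tF a | tAdjF a => signed_occ r x (child_sign (eta_f sg) s) a
  | tG a | tAdjG a => signed_occ r x (child_sign (eta_g sg) s) a
  | tK ts => exists i, signed_occ r x (child_sign (eps_k i) s) (ts i)
  | tL ts => exists i, signed_occ r x (child_sign (eps_l i) s) (ts i)
  | tImp a b => signed_occ r x (flip s) a \/ signed_occ r x s b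
  | tSub a b => signed_occ r x s a \/ signed_occ r x (flip s) b
  end.

Section Occurrences.
Context {sg : signature}.

Definition occurs (x : atom) (t : term sg) : Prop :=
  exists r, signed_occ r x Plus t.

Definition positive (p : nat) (t : term sg) : Prop :=
  ~ signed_occ Minus (PVar p) Plus t.

Definition negative (p : nat) (t : term sg) : Prop :=
  ~ signed_occ Plus (PVar p) Plus t.

End Occurrences.

(* [(a, b)] stands for the inequality a <= b. *)
Notation ineq sg := (term sg * term sg)%type.

(* Lists of inequalities represent finite sets; see [replace]. *)
Notation system sg := (seq (ineq sg)).

Record quasi (sg : signature) := Quasi {
  premises : system sg;
  conclusion : ineq sg
}.

Section Systems.
Context {sg : signature}.

Definition occurs_ineq (x : atom) (I : ineq sg) : Prop :=
  occurs x I.1 \/ occurs x I.2.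

Definition pure (S : system sg) : Prop :=
  forall I p, List.In I S -> ~ occurs_ineq (PVar p) I.

Definition same_set (S T : system sg) : Prop :=
  forall I, List.In I S <-> List.In I T.

(* [T] is the set [S] in which the member [I] is replaced by those of [new]. *)
Definition replace (S : system sg) (I : ineq sg) (new T : system sg) : Prop :=
  exists2 R, same_set S (I :: R) & ~ List.In I R /\ T = new ++ R.

Definition subst_ineq (p : nat) (u : term sg) (I : ineq sg) : ineq sg :=
  (subst p u I.1, subst p u I.2).

End Systems.

(* [push s t t']: one distribution step, at an arbitrary position, in the
   generation tree of [t] with root signed [s].  Every node signed +\/ or -/\
   is SAC, so the SAC proviso on the node distributed over is automatic. *)
Inductive push {sg : signature} : sign -> term sg -> term sg -> Prop :=
| push_andl a b c :
    push Plus (tAnd (tOr a b) c) (tOr (tAnd a c) (tAnd b c))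
| push_andr a b c :
    push Plus (tAnd c (tOr a b)) (tOr (tAnd c a) (tAnd c b))
| push_f1 a b : eta_f sg = One ->
    push Plus (tF (tOr a b)) (tOr (tF a) (tF b))
| push_gd a b : eta_g sg = Dual ->
    push Minus (tG (tOr a b)) (tAnd (tG a) (tG b))
| push_k1 ts i a b : eps_k i = One -> ts i = tOr a b ->
    push Plus (tK ts) (tOr (tK (upd ts i a)) (tK (upd ts i b)))
| push_ld ts i a b : eps_l i = Dual -> ts i = tOr a b ->
    push Minus (tL ts) (tAnd (tL (upd ts i a)) (tL (upd ts i b)))
| push_orl a b c :
    push Minus (tOr (tAnd a b) c) (tAnd (tOr a c) (tOr b c))
| push_orr a b c :
    push Minus (tOr c (tAnd a b)) (tAnd (tOr c a) (tOr c b))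
| push_g1 a b : eta_g sg = One ->
    push Minus (tG (tAnd a b)) (tAnd (tG a) (tG b))
| push_fd a b : eta_f sg = Dual ->
    push Plus (tF (tAnd a b)) (tOr (tF a) (tF b))
| push_kd ts i a b : eps_k i = Dual -> ts i = tAnd a b ->
    push Plus (tK ts) (tOr (tK (upd ts i a)) (tK (upd ts i b)))
| push_l1 ts i a b : eps_l i = One -> ts i = tAnd a b ->
    push Minus (tL ts) (tAnd (tL (upd ts i a)) (tL (upd ts i b)))
| push_in_andl s a a' b : push s a a' -> push s (tAnd a b) (tAnd a' b)
| push_in_andr s a b b' : push s b b' -> push s (tAnd a b) (tAnd a b')
| push_in_orl s a a' b : push s a a' -> push s (tOr a b) (tOr a' b)
| push_in_orr s a b b' : push s b b' -> push s (tOr a b) (tOr a b')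
| push_in_f s a a' : push (child_sign (eta_f sg) s) a a' ->
    push s (tF a) (tF a')
| push_in_g s a a' : push (child_sign (eta_g sg) s) a a' ->
    push s (tG a) (tG a')
| push_in_k s ts i a' : push (child_sign (eps_k i) s) (ts i) a' ->
    push s (tK ts) (tK (upd ts i a'))
| push_in_l s ts i a' : push (child_sign (eps_l i) s) (ts i) a' ->
    push s (tL ts) (tL (upd ts i a'))
| push_in_impl s a a' b : push (flip s) a a' -> push s (tImp a b) (tImp a' b)
| push_in_impr s a b b' : push s b b' -> push s (tImp a b) (tImp a b').

Variant splitting {sg : signature} : ineq sg -> system sg -> Prop :=
| split_and a b c : splitting (a, tAnd b c) [:: (a, b); (a, c)]
| split_or a b c : splitting (tOr a b, c) [:: (a, c); (b, c)].

(* Elimination of [p] requires that it occurs: otherwise the step would be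
   applicable forever, and "exhaustively" meaningless. *)
Variant preprocess_rule {sg : signature} : ineq sg -> system sg -> Prop :=
| pre_push_left a a' b : push Plus a a' ->
    preprocess_rule (a, b) [:: (a', b)]
| pre_push_right a b b' : push Minus b b' ->
    preprocess_rule (a, b) [:: (a, b')]
| pre_split I new : splitting I new -> preprocess_rule I new
| pre_elim_bot p a b : occurs_ineq (PVar p) (a, b) ->
    negative p a -> positive p b ->
    preprocess_rule (a, b) [:: (subst p tBot a, subst p tBot b)]
| pre_elim_top p a b : occurs_ineq (PVar p) (b, a) ->
    positive p b -> negative p a ->
    preprocess_rule (b, a) [:: (subst p tTop b, subst p tTop a)].

Definition preprocess_step {sg : signature} (S T : system sg) : Prop :=
  exists I new, preprocess_rule I new /\ replace S I new T.

Definition preprocess {sg : signature} (I : ineq sg) (S : system sg) : Prop :=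
  Relation_Operators.clos_refl_trans _ preprocess_step [:: I] S /\
  forall T, ~ preprocess_step S T.

(* The nominal i_0 and the conominal m_0 of the first approximation are the
   ones of index 0. *)
Definition first_approx {sg : signature} (I : ineq sg) : system sg :=
  [:: (tNom 0, I.1); (I.2, tCon 0)].

(* Freshness with respect to the quasi-inequality & S => i_0 <= m_0. *)
Definition fresh {sg : signature} (S : system sg) (x : atom) : Prop :=
  [/\ x <> Nominal 0, x <> Conominal 0
    & forall I, List.In I S -> ~ occurs_ineq x I].

(* The alternatives of the approximation rules for k and l are indexed by the
   sets X = P :|: N, so that P and N are the coordinates in X of order type 1
   and of order type dual, respectively. *)
Definition k_alternative {sg : signature} (i : nat)
    (ts : 'I_(ar_k sg) -> term sg) (js ms : 'I_(ar_k sg) -> nat)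
    (X : {set 'I_(ar_k sg)}) : system sg :=
  (tNom i, tK (fun e => match eps_k e with
                        | One => if e \in X then tNom (js e) else tBot
                        | Dual => if e \in X then tCon (ms e) else tTop
                        end))
  :: [seq match eps_k e with
          | One => (tNom (js e), ts e)
          | Dual => (ts e, tCon (ms e))
          end | e <- enum X].

Definition l_alternative {sg : signature} (m : nat)
    (ts : 'I_(ar_l sg) -> term sg) (ns js : 'I_(ar_l sg) -> nat)
    (X : {set 'I_(ar_l sg)}) : system sg :=
  (tL (fun e => match eps_l e with
                | One => if e \in X then tCon (ns e) else tTop
                | Dual => if e \in X then tNom (js e) else tBot
                end), tCon m)
  :: [seq match eps_l e with
          | One => (ts e, tCon (ns e))
          | Dual => (tNom (js e), ts e)
          end | e <- enum X].

(* [reduce_rule L S I alts]: in the system [S], the inequality [I] may be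
   replaced by any of the alternatives in [alts]. *)
Variant reduce_rule (L : logic) {sg : signature} (S : system sg) :
    ineq sg -> seq (system sg) -> Prop :=
| red_split I new : splitting I new -> reduce_rule L S I [:: new]
| red_and a b c :
    reduce_rule L S (tAnd a b, c) [:: [:: (b, tImp a c)]]
| red_imp a b c : L = HAR ->
    reduce_rule L S (b, tImp a c) [:: [:: (tAnd a b, c)]]
| red_or a b c :
    reduce_rule L S (a, tOr b c) [:: [:: (tSub a c, b)]]
| red_adj_f1 a b : eta_f sg = One ->
    reduce_rule L S (tF a, b) [:: [:: (tF tBot, b); (a, tAdjF b)]]
| red_adj_fd a b : eta_f sg = Dual ->
    reduce_rule L S (tF a, b) [:: [:: (tF tTop, b); (tAdjF b, a)]]
| red_adj_g1 a b : eta_g sg = One ->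
    reduce_rule L S (a, tG b) [:: [:: (a, tG tTop); (tAdjG a, b)]]
| red_adj_gd a b : eta_g sg = Dual ->
    reduce_rule L S (a, tG b) [:: [:: (a, tG tBot); (b, tAdjG a)]]
| red_app_f1 i j a : eta_f sg = One -> fresh S (Nominal j) ->
    reduce_rule L S (tNom i, tF a)
      [:: [:: (tNom i, tF tBot)];
          [:: (tNom j, a); (tNom i, tF (tNom j))]]
| red_app_fd i m a : eta_f sg = Dual -> fresh S (Conominal m) ->
    reduce_rule L S (tNom i, tF a)
      [:: [:: (tNom i, tF tTop)];
          [:: (a, tCon m); (tNom i, tF (tCon m))]]
| red_app_g1 m n a : eta_g sg = One -> fresh S (Conominal n) ->
    reduce_rule L S (tG a, tCon m)
      [:: [:: (tG tTop, tCon m)];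
          [:: (a, tCon n); (tG (tCon n), tCon m)]]
| red_app_gd m i a : eta_g sg = Dual -> fresh S (Nominal i) ->
    reduce_rule L S (tG a, tCon m)
      [:: [:: (tG tBot, tCon m)];
          [:: (tNom i, a); (tG (tNom i), tCon m)]]
| red_app_k i ts js ms :
    injective js -> (forall e, fresh S (Nominal (js e))) ->
    injective ms -> (forall e, fresh S (Conominal (ms e))) ->
    reduce_rule L S (tNom i, tK ts)
      [seq k_alternative i ts js ms X | X : {set 'I_(ar_k sg)}]
| red_app_l m ts ns js :
    injective ns -> (forall e, fresh S (Conominal (ns e))) ->
    injective js -> (forall e, fresh S (Nominal (js e))) ->
    reduce_rule L S (tL ts, tCon m)
      [seq l_alternative m ts ns js X | X : {set 'I_(ar_l sg)}]
| red_app_imp a b m j n : L = HAR ->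
    fresh S (Nominal j) -> fresh S (Conominal n) ->
    reduce_rule L S (tImp a b, tCon m)
      [:: [:: (tNom j, a); (b, tCon n); (tImp (tNom j) (tCon n), tCon m)]].

Variant reduce_system (L : logic) {sg : signature} (S : system sg) :
    seq (system sg) -> Prop :=
| reduce_ineq I alts R :
    same_set S (I :: R) -> ~ List.In I R -> reduce_rule L S I alts ->
    reduce_system L S [seq new ++ R | new <- alts]
| reduce_ackermann_right p us R :
    same_set S ([seq (u, tVar p) | u <- us] ++ R) ->
    (forall u, List.In u us -> ~ occurs (PVar p) u) ->
    (forall I, List.In I R -> positive p I.1 /\ negative p I.2) ->
    reduce_system L S [:: [seq subst_ineq p (bigOr us) J | J <- R]]
| reduce_ackermann_left p us R :
    same_set S ([seq (tVar p, u) | u <- us] ++ R) ->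
    (forall u, List.In u us -> ~ occurs (PVar p) u) ->
    (forall I, List.In I R -> negative p I.1 /\ positive p I.2) ->
    reduce_system L S [:: [seq subst_ineq p (bigAnd us) J | J <- R]].

Variant reduce_step (L : logic) {sg : signature} :
    seq (system sg) -> seq (system sg) -> Prop :=
| ReduceStep Ss1 S Ss2 alts : reduce_system L S alts ->
    reduce_step L (Ss1 ++ S :: Ss2) (Ss1 ++ alts ++ Ss2).

(* [ALBAr L I Q]: some successful run on the inequality [I] outputs [Q]. *)
Definition ALBAr (L : logic) {sg : signature} (I : ineq sg)
    (Q : seq (quasi sg)) : Prop :=
  exists Is finals,
    [/\ preprocess I Is,
        Relation_Operators.clos_refl_trans _ (@reduce_step L sg)
          [seq first_approx J | J <- Is] finals,
        forall S, List.In S finals -> pure S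
      & Q = [seq Quasi T (tNom 0, tCon 0) | T <- finals]].

Section Interpretation.
Context {L : logic} {sg : signature} {d : Order.disp_t}.
Context {A : tbDistrLatticeType d} (X : algebra L sg A).

(* The operations below are only meant for perfect algebras, where the objects
   they are described by exist and are unique. *)

Definition heyting (a b : A) : A :=
  xget \bot [set c : A | forall x : A, x <= c <-> a `&` x <= b].

(* The basic operation of a HAR, the Heyting implication of the lattice of a
   DLR. *)
Definition imp : A -> A -> A :=
  match L return algebra L sg A -> A -> A -> A with
  | DLR => fun=> heyting
  | HAR => fun Y => op_imp Y
  end X.

Definition sub (a b : A) : A :=
  xget \bot [set c : A | forall x : A, c <= x <-> a <= b `|` x].

Let f := op_f (dlr_of X).
Let g := op_g (dlr_of X).

Definition diamond_f (u : A) : A :=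
  bigsup [set j | Jinf j /\ exists i, [/\ Jinf i, i <= u & j <= f i]].
Definition lhd_f (u : A) : A :=
  bigsup [set j | Jinf j /\ exists m, [/\ Minf m, u <= m & j <= f m]].
Definition box_g (u : A) : A :=
  biginf [set n | Minf n /\ exists m, [/\ Minf m, u <= m & g m <= n]].
Definition rhd_g (u : A) : A :=
  biginf [set n | Minf n /\ exists i, [/\ Jinf i, i <= u & g i <= n]].

Definition adj_f (v : A) : A :=
  match eta_f sg with
  | One => xget \bot [set w : A | forall u, diamond_f u <= v <-> u <= w]
  | Dual => xget \bot [set w : A | forall u, lhd_f u <= v <-> w <= u]
  end.

Definition adj_g (v : A) : A :=
  match eta_g sg with
  | One => xget \bot [set w : A | forall u, w <= u <-> v <= box_g u]
  | Dual => xget \bot [set w : A | forall u, v <= rhd_g u <-> u <= w]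
  end.

Fixpoint eval (e : atom -> A) (t : term sg) : A :=
  match t with
  | tAtom x => e x
  | tTop => \top
  | tBot => \bot
  | tAnd a b => eval e a `&` eval e b
  | tOr a b => eval e a `|` eval e b
  | tF a => f (eval e a)
  | tG a => g (eval e a)
  | tK ts => op_k (dlr_of X) (fun i => eval e (ts i))
  | tL ts => op_l (dlr_of X) (fun i => eval e (ts i))
  | tImp a b => imp (eval e a) (eval e b)
  | tSub a b => sub (eval e a) (eval e b)
  | tAdjF a => adj_f (eval e a)
  | tAdjG a => adj_g (eval e a)
  end.

Definition assignment (e : atom -> A) : Prop :=
  forall n, Jinf (e (Nominal n)) /\ Minf (e (Conominal n)).

Definition holds (e : atom -> A) (I : ineq sg) : Prop :=
  eval e I.1 <= eval e I.2.

Definition valid (I : ineq sg) : Prop :=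
  forall e, assignment e -> holds e I.

Definition valid_quasi (q : quasi sg) : Prop :=
  forall e, assignment e ->
    (forall I, List.In I (premises q) -> holds e I) -> holds e (conclusion q).

Definition valid_all (Q : seq (quasi sg)) : Prop :=
  forall q, List.In q Q -> valid_quasi q.

End Interpretation.

(* Main.v *)
Require Import Defs.
From mathcomp Require Import all_boot all_order.
From mathcomp Require Import boolp classical_sets.
Import Order.TTheory.

(* A completely join-irreducible element of a perfect lattice is completely
   join-prime, and dually; hence the residuals and the adjoints exist, and an
   inequality i <= f(phi) is witnessed by a generator below phi (or by bottom,
   since f need not preserve the empty join).  So every step of a run preserves
   validity: preprocessing rewrites terms into equal ones or sends a variable to
   its extremal value, the adjunction and residuation rules are equivalences,
   the approximation rules are conservative because the witnesses are named by
   fresh nominals and conominals, and the Ackermann rules follow from the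
   monotonicity of signed terms.

   Both orientations are handled at once: [o : otype] selects the
   order of A^o. *)

Set Implicit Arguments.
Unset Strict Implicit.
Unset Printing Implicit Defensive.

Local Open Scope classical_set_scope.
Local Open Scope order_scope.

(** * Perfect lattices in either orientation: primeness of generators and existence of residuals *)

Definition dualo (o : otype) : otype := if o is One then Dual else One.

Section PerfectLattices.
Context {d : Order.disp_t} {A : tbDistrLatticeType d}.
Implicit Types (o : otype) (a b c j : A) (S : set A).

Definition ole o a b : bool := if o is One then a <= b else b <= a.

(** The completely join-irreducible elements of [A^o]: meet-irreducibility is join-irreducibility in
    the order dual. *)
Definition gen o : set A := if o is One then Jinf else Minf.
Definition obot o : A := if o is One then \bot else \top.

Lemma ole_refl o a : ole o a a.
Proof. by case: o => /=. Qed.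

Lemma ole_trans o b a c : ole o a b -> ole o b c -> ole o a c.
Proof. by case: o => /= ab bc; [exact: le_trans bc | exact: le_trans ab]. Qed.

Lemma ole_anti o a b : ole o a b -> ole o b a -> a = b.
Proof. by case: o => /= ab ba; apply/le_anti; rewrite ab ba. Qed.

Lemma ole_dual o a b : ole (dualo o) a b = ole o b a.
Proof. by case: o. Qed.

Lemma ole_obot o a : ole o (obot o) a.
Proof. by case: o => /=; rewrite ?le0x ?lex1. Qed.

Lemma ole_omeet o a b c : ole o c (omeet o a b) = ole o c a && ole o c b.
Proof. by case: o => /=; rewrite ?lexI ?leUx. Qed.

Lemma osups_dual o S s : osups (dualo o) S s = oinfs o S s.
Proof. by case: o. Qed.

Lemma osups_ub o S s a : osups o S s -> S a -> ole o a s.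
Proof. by case: o => -[ub _] /ub. Qed.

Lemma osups_lub o S s b :
  osups o S s -> (forall a, S a -> ole o a b) -> ole o s b.
Proof. by case: o => -[_ lub] Sb; apply: lub => a /Sb. Qed.

Lemma osupsI o S s : (forall a, S a -> ole o a s) ->
  (forall b, (forall a, S a -> ole o a b) -> ole o s b) -> osups o S s.
Proof.
by case: o => ub lub; split=> [a /ub //|b Sb]; apply: lub => a /Sb.
Qed.

Lemma osups_pair o a b : ole o a b -> osups o [set a; b] b.
Proof.
move=> ab; apply: osupsI => [c [->|->]//|c]; first exact: ole_refl.
by apply; right.
Qed.

Hypothesis PA : perfect_lattice A.

Definition osup o S : A := if o is One then bigsup S else biginf S.

Lemma osupP o S : osups o S (osup o S).
Proof.
case: o => /=; rewrite /bigsup /biginf /supremum /infimum;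
  case: ifPn => [/eqP ->|_].
(* On the empty set [bigsup] returns its default [\bot], which is the correct supremum there;
   [biginf] likewise returns [\top]. *)
- by apply: (@osupsI One) => //= b _; exact: le0x.
- exact: xgetPex (perfect_sup PA S).
- by apply: (@osupsI Dual) => //= b _; exact: lex1.
- exact: xgetPex (perfect_inf PA S).
Qed.

(** Complete distributivity rewrites [j = j /\ sup S] as the join of the elements [j /\ a] with [a]
    in [S]. Irreducibility makes [j] one of these, hence [j <= a]. *)
Lemma Jinf_prime S s j :
  Jinf j -> supremums S s -> j <= s -> exists2 a, S a & j <= a.
Proof.
move=> Jj Ss js.
(* The two-member family to distribute over: the constant [j] at [true], the elements of [S] at
   [false]. A choice function then amounts to picking one element of [S]. *)
pose K (b : bool) := match b return Type with
  true => unit | false => {x : A | S x} end.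
pose x (b : bool) : K b -> A :=
  match b with true => fun=> j | false => fun y => sval y end.
have := perfect_distributive PA x.
set lhs := biginf _; set R := (X in _ = bigsup X) => E.
have jE : j = lhs.
  apply: (@ole_anti One) => /=.
    apply: (osups_lub (o := Dual) (osupP Dual _)) => _ [b _ <-].
    case: b => /=.
      by apply: (osups_ub (osupP One _)); exists tt.
    apply: le_trans js _; apply: (osups_lub (o := One) Ss) => a Sa.
    by apply: (osups_ub (osupP One _)); exists (exist _ a Sa).
  apply: (@le_trans _ _ (bigsup (range (x true)))).
    by apply: (osups_ub (osupP Dual _)); exists true.
  by apply: (osups_lub (o := One) (osupP One _)) => _ [? _ <-] /=.
have : supremums R j by rewrite jE E; exact: (osupP One).
move/Jj => [c _ cj]; exists (sval (c false)); first exact: svalP (c false).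
by rewrite -[X in X <= _]cj; apply: (osups_ub (osupP Dual _)); exists false.
Qed.

(** Some set of generators has supremum [a]. Enlarging it to all generators below [a] leaves the
    supremum unchanged. *)
Lemma gen_sup o a : osups o [set j | gen o j /\ ole o j a] a.
Proof.
have [S SG Sa] : exists2 S : set A, S `<=` gen o & osups o S a.
  case: o; first exact: (perfect_join_generated PA a).
  exact: (perfect_meet_generated PA a).
apply: osupsI => [j /= []//|b jb]; apply: (osups_lub Sa) => c Sc; apply: jb.
by split; [exact: SG | exact: osups_ub Sa Sc].
Qed.

Lemma ole_gen o a b :
  (forall j, gen o j -> ole o j a -> ole o j b) -> ole o a b.
Proof. by move=> jab; apply: osups_lub (gen_sup o a) _ => j []; exact: jab. Qed.

(** The distributive law turns meets of joins into joins of meets, so [Jinf_prime] is not simply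
    read in the order dual. Irreducibility of [m] is applied to the elements [m \/ a], whose infimum
    is [m]: a join-prime [j] below all of them but not below [m] would lie below every [a], hence
    below [s <= m]. *)
Lemma Minf_prime S s m :
  Minf m -> infimums S s -> s <= m -> exists2 a, S a & a <= m.
Proof.
move=> Mm Ss sm.
have : infimums [set m `|` a | a in S] m.
  apply: (@osupsI Dual) => /= [_ [a _ <-]|b mb]; first exact: leUl.
  apply: (@ole_gen One) => j /= Jj jb; apply: contrapT => jm.
  apply: (jm); apply: le_trans sm; apply: (osups_lub (o := Dual) Ss) => a Sa /=.
  have jma : j <= m `|` a by apply: le_trans jb _; apply: mb; exists a.
  have Sma : supremums [set m; a] (m `|` a).
    apply: (@osupsI One) => /= [_ [->|->]|c mac]; rewrite ?leUl ?leUr//.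
    by rewrite leUx !mac//; [right|left].
  by have [_ [->|->]//] := Jinf_prime Jj Sma jma.
by move/Mm => [a Sa <-]; exists a => //; exact: leUr.
Qed.

Lemma gen_prime o S s j :
  gen o j -> osups o S s -> ole o j s -> exists2 a, S a & ole o j a.
Proof. by case: o; [exact: Jinf_prime | exact: Minf_prime]. Qed.

(** The supremum of all solutions [x] is itself a solution, because a generator below both [a] and
    this supremum is prime and so lies below a single solution. [One] gives the Heyting implication,
    [Dual] the subtraction. *)
Lemma residual_exists o a b :
  exists c, forall x, ole o x c <-> ole o (omeet o a x) b.
Proof.
pose S := [set x | ole o (omeet o a x) b].
exists (osup o S) => x; split=> [xc|xS]; last exact: osups_ub (osupP o S) _.
apply: ole_gen => j Gj; rewrite ole_omeet => /andP[ja jx].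
have [y /= yS jy] := gen_prime Gj (osupP o S) (ole_trans jx xc).
by apply: ole_trans yS; rewrite ole_omeet ja.
Qed.

(** * Unary operations preserving non-empty suprema, and their adjoints *)

Definition preserves_sups o1 o2 (h : A -> A) : Prop :=
  forall S s, S !=set0 -> osups o1 S s -> osups o2 (h @` S) (h s).

Section UnaryOperation.
Variables (o1 o2 : otype) (h : A -> A).
Hypothesis hP : preserves_sups o1 o2 h.

Lemma preserves_sups_homo a b : ole o1 a b -> ole o2 (h a) (h b).
Proof.
move=> ab; have := hP (S := [set a; b]) _ (osups_pair ab).
move=> /(_ (ex_intro _ a (or_introl erefl))) /osups_ub; apply.
by exists a => //; left.
Qed.

(** If some generator lies below [a], then [h a] is the supremum of the values at these generators
    and primeness of [j] selects one. Otherwise [a] is the empty supremum, about which [h] says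
    nothing; this is the source of the alternative at bottom in the approximation rules. *)
Lemma gen_le_op a j : gen o2 j -> ole o2 j (h a) ->
  ole o2 j (h (obot o1)) \/
  exists c, [/\ gen o1 c, ole o1 c a & ole o2 j (h c)].
Proof.
move=> Gj jha; have aP := gen_sup o1 a.
have [S0|/set0P S0] := eqVneq [set c | gen o1 c /\ ole o1 c a] set0.
  left; apply: ole_trans jha (preserves_sups_homo _).
  by apply: osups_lub aP _ => c; rewrite S0.
right; have [_ [c [Gc ca] <-] jc] := gen_prime Gj (hP S0 aP) jha.
by exists c.
Qed.

Section Adjoint.
Variable D : A -> A.
Hypothesis DP : forall u, osups o2
  [set j | gen o2 j /\ exists c, [/\ gen o1 c, ole o1 c u & ole o2 j (h c)]]
  (D u).

(** In the order of [A^o2], [h a] is the join of [h] at bottom and of [D a], the part generated by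
    the generators below [a]. The first conjunct is the side condition of the adjunction rules. *)
Lemma op_le_split a b :
  ole o2 (h a) b <-> ole o2 (h (obot o1)) b /\ ole o2 (D a) b.
Proof.
split=> [hab|[hb Dab]].
  split; first exact: ole_trans (preserves_sups_homo (ole_obot _ _)) hab.
  apply: osups_lub (DP a) _ => j [_ [c [_ ca jc]]].
  exact: ole_trans jc (ole_trans (preserves_sups_homo ca) hab).
apply: ole_gen => j Gj /(gen_le_op Gj)[jb|jc]; first exact: ole_trans hb.
by apply: ole_trans Dab; apply: osups_ub (DP a) _.
Qed.

(** The adjoint is the supremum of all [u] with [D u] below [v]. It qualifies since [D] is
    determined by generators below its argument, and each generator below the supremum is already
    below some such [u]. *)
Lemma adjoint_exists v : exists w, forall u, ole o2 (D u) v <-> ole o1 u w.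
Proof.
pose S := [set u | ole o2 (D u) v].
exists (osup o1 S) => u; split=> [uS|uw]; first exact: osups_ub (osupP o1 S) _.
apply: osups_lub (DP u) _ => j [Gj [c [Gc cu jc]]].
have [y /= yS cy] := gen_prime Gc (osupP o1 S) (ole_trans cu uw).
by apply: ole_trans yS; apply: osups_ub (DP y) _; split=> //; exists c.
Qed.

End Adjoint.
End UnaryOperation.

(** * Operations of finite arity, treated one coordinate at a time *)

Section FiniteArityOperation.
Variables (n : nat) (o : 'I_n -> otype) (o2 : otype) (h : ('I_n -> A) -> A).
Hypothesis hP : forall x i, preserves_sups (o i) o2 (fun a => h (upd x i a)).

Lemma upd_id T (x : 'I_n -> T) i : upd x i (x i) = x.
Proof. by apply/funext => e; rewrite /upd; case: eqP => [->|]. Qed.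

Lemma coordinatewise_homo x y :
  (forall i, ole (o i) (x i) (y i)) -> ole o2 (h x) (h y).
Proof.
(* The coordinates in the list [s] have already been moved from [x] to [y]; each new one is a single
   unary step. *)
move=> xy; have xyS (s : seq 'I_n) :
    ole o2 (h x) (h (fun i => if i \in s then y i else x i)).
  elim: s => [|i s IHs]; first exact: ole_refl.
  set z := fun i => _ in IHs; apply: ole_trans IHs _.
  rewrite -[z in h z](upd_id z i).
  have -> : (fun e => if e \in i :: s then y e else x e) = upd z i (y i).
    by apply/funext => e; rewrite /upd /z in_cons; case: eqP => [->|].
  have := @preserves_sups_homo _ _ _ (@hP z i) (z i) (y i); apply; rewrite {}/z.
  by case: ifP => _ //; exact: ole_refl.
have := xyS (enum 'I_n); rewrite (_ : (fun i => _) = y) //.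
by apply/funext => i; rewrite mem_enum.
Qed.

Lemma gen_le_coordinatewise x j : gen o2 j -> ole o2 j (h x) ->
  exists (X : {set 'I_n}) (c : 'I_n -> A),
    (forall i, i \in X -> gen (o i) (c i) /\ ole (o i) (c i) (x i)) /\
    ole o2 j (h (fun i => if i \in X then c i else obot (o i))).
Proof.
move=> Gj jx.
have [z zP jz] : exists2 z : 'I_n -> A, (forall i, z i = obot (o i) \/
    gen (o i) (z i) /\ ole (o i) (z i) (x i)) & ole o2 j (h z).
  (* Induction on the list of treated coordinates: these hold bottom or a generator, while the
     others still hold [x i], so that [gen_le_op] applies to the next one. *)
  suff [z [zP _ jz]] : exists z : 'I_n -> A, [/\ (forall i, i \in enum 'I_n ->
        z i = obot (o i) \/ gen (o i) (z i) /\ ole (o i) (z i) (x i)),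
      (forall i, i \notin enum 'I_n -> z i = x i) & ole o2 j (h z)].
    by exists z => // i; apply: zP; rewrite mem_enum.
  elim: (enum 'I_n) => [|i s [z [zP zx jz]]]; first by exists x.
  have [si|si] := boolP (i \in s).
    exists z; split=> // e; rewrite in_cons; first by case/predU1P => [->|]; exact: zP.
    by rewrite negb_or => /andP[_]; exact: zx.
  rewrite -[z in h z](upd_id z i) in jz.
  have zi := zx i si.
  have [c cP jc] : exists2 c, c = obot (o i) \/ gen (o i) c /\ ole (o i) c (x i)
      & ole o2 j (h (upd z i c)).
    have [jb|[c [Gc ca jc]]] := gen_le_op (@hP z i) (a := z i) Gj jz.
      by exists (obot (o i)) => //; left.
    by exists c => //; right; rewrite -zi.
  exists (upd z i c); split=> // e; rewrite in_cons /upd;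
    case: eqP => [-> //|_] //=; [exact: zP | exact: zx].
(* The coordinates not at bottom must carry generators; outside this set [z] agrees with the default
   [obot]. *)
exists [set i | z i != obot (o i)]%SET, z; split=> [i|].
  by rewrite inE => /eqP zi; case: (zP i).
rewrite -[X in h X](_ : z = _) //; apply/funext => i.
by rewrite inE; case: eqP.
Qed.

End FiniteArityOperation.
End PerfectLattices.

(** * Membership in lists *)

Section Lists.
Context {T U : Type}.

Lemma In_cat (x : T) s1 s2 :
  List.In x (s1 ++ s2) <-> List.In x s1 \/ List.In x s2.
Proof. by elim: s1 => [|y s IH] /=; tauto. Qed.

Lemma In_map (f : T -> U) s y :
  List.In y (map f s) <-> exists2 x, List.In x s & f x = y.
Proof.
elim: s => [|z s IH] /=; first by split=> // -[].
rewrite IH; split=> [[fz|[x xs fx]]|[x [<-|xs] fx]].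
- by exists z => //; left.
- by exists x => //; right.
- by left.
- by right; exists x.
Qed.

End Lists.

Lemma In_mem (T : eqType) (x : T) s : List.In x s <-> x \in s.
Proof.
elim: s => [|y s IH] //=; rewrite in_cons IH; split.
  by case=> [->|->]; rewrite ?eqxx ?orbT.
by case/predU1P; [left|right].
Qed.

(** * Terms of the basic language and occurrences of atoms *)

Section Syntax.
Context {L : logic} {sg : signature}.
Implicit Types (t u : term sg) (s r : sign) (x : atom).

(** This allows [Nominal 0] and [Conominal 0] to be reassigned in the first approximation without
    changing the input terms. Induction runs over all root signs, as antitone coordinates flip
    them. *)
Lemma Lterm_occurs t x : Lterm L t -> occurs x t -> exists p, x = PVar p.
Proof.
suff H s r : Lterm L t -> signed_occ r x s t -> exists p, x = PVar p.
  by move=> Lt [r]; exact: H.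
elim: t s => //=.
- by case=> // p s _ [<- _]; exists p.
- by move=> a IHa b IHb s [/IHa{}IHa /IHb{}IHb] [/IHa|/IHb].
- by move=> a IHa b IHb s [/IHa{}IHa /IHb{}IHb] [/IHa|/IHb].
- by move=> a IHa s La /IHa; exact.
- by move=> a IHa s La /IHa; exact.
- by move=> ts IH s Lts [i /IH]; exact.
- by move=> ts IH s Lts [i /IH]; exact.
- by move=> a IHa b IHb s [_ [/IHa{}IHa /IHb{}IHb]] [/IHa|/IHb].
Qed.

Lemma Lterm_subst p u t : Lterm L u -> Lterm L t -> Lterm L (subst p u t).
Proof.
move=> Lu; elim: t => //=; try by move=> *; intuition.
by case=> // q _; case: ifP.
Qed.

Lemma Lterm_upd n (ts : 'I_n -> term sg) i t :
  (forall j, Lterm L (ts j)) -> Lterm L t -> forall j, Lterm L (upd ts i t j).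
Proof. by move=> Lts Lt j; rewrite /upd; case: ifP. Qed.

Lemma Lterm_push s t t' : push s t t' -> Lterm L t -> Lterm L t'.
Proof.
elim=> {s t t'} /=; try by move=> *; intuition.
- by move=> ts i a b _ E Lts; have := Lts i; rewrite E => -[La Lb];
    split; exact: Lterm_upd.
- by move=> ts i a b _ E Lts; have := Lts i; rewrite E => -[La Lb];
    split; exact: Lterm_upd.
- by move=> ts i a b _ E Lts; have := Lts i; rewrite E => -[La Lb];
    split; exact: Lterm_upd.
- by move=> ts i a b _ E Lts; have := Lts i; rewrite E => -[La Lb];
    split; exact: Lterm_upd.
- by move=> s ts i a' _ IH Lts; apply: Lterm_upd => //; exact: IH.
- by move=> s ts i a' _ IH Lts; apply: Lterm_upd => //; exact: IH.
Qed.

Definition Lsystem (S : system sg) : Prop :=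
  forall I, List.In I S -> Lterm L I.1 /\ Lterm L I.2.

Lemma Lterm_preprocess_rule I new : preprocess_rule I new ->
  Lterm L I.1 -> Lterm L I.2 -> Lsystem new.
Proof.
case=> {I new} /=.
- by move=> a a' b /Lterm_push aa' La Lb J /= [<-|//]; split=> //; exact: aa'.
- by move=> a b b' /Lterm_push bb' La Lb J /= [<-|//]; split=> //; exact: bb'.
- move=> I new [a b c|a b c] /= L1 L2 J /= [<-|[<-|//]] /=; tauto.
- by move=> p a b _ _ _ La Lb J /= [<-|//]; split; exact: Lterm_subst.
- by move=> p a b _ _ _ La Lb J /= [<-|//]; split; exact: Lterm_subst.
Qed.

(** Keeps the preprocessed inequalities within the scope of the first approximation rule. *)
Lemma Lterm_preprocess_steps S T :
  Relation_Operators.clos_refl_trans _ preprocess_step S T ->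
  Lsystem S -> Lsystem T.
Proof.
elim=> {S T} [S T [I [new [IP [R SR [_ ->]]]]] LS J|//|S T U _ H1 _ H2 /H1/H2//].
move/In_cat => [|JR]; last by apply: LS; apply/SR; right.
have [L1 L2] : Lterm L I.1 /\ Lterm L I.2 by apply: LS; apply/SR; left.
exact: (Lterm_preprocess_rule IP L1 L2).
Qed.

Lemma child_sign_flip o s : child_sign o (flip s) = flip (child_sign o s).
Proof. by case: o; case: s. Qed.

Lemma signed_occ_flip r x s t :
  signed_occ r x s t -> signed_occ (flip r) x (flip s) t.
Proof.
elim: t s => //=; try by move=> *; rewrite ?child_sign_flip; intuition.
- by move=> y s [-> ->].
- by move=> ts IH s [i /IH]; rewrite -child_sign_flip; exists i.
- by move=> ts IH s [i /IH]; rewrite -child_sign_flip; exists i.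
Qed.

(** [occurs] fixes a positive root, whereas a subterm at an antitone coordinate has a negative one;
    flipping every sign passes between the two. *)
Lemma occurs_signed s x t : occurs x t -> exists r, signed_occ r x s t.
Proof.
by case: s => -[r H]; [exists r | exists (flip r); exact: signed_occ_flip H].
Qed.

Lemma occurs_tF x t : occurs x t -> occurs x (tF t).
Proof. by move/(occurs_signed (child_sign (eta_f sg) Plus)). Qed.

Lemma occurs_tG x t : occurs x t -> occurs x (tG t).
Proof. by move/(occurs_signed (child_sign (eta_g sg) Plus)). Qed.

Lemma occurs_tK x ts i : occurs x (ts i) -> occurs (sg := sg) x (tK ts).
Proof.
by move/(occurs_signed (child_sign (eps_k i) Plus)) => -[r]; exists r, i.
Qed.

Lemma occurs_tL x ts i : occurs x (ts i) -> occurs (sg := sg) x (tL ts).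
Proof.
by move/(occurs_signed (child_sign (eps_l i) Plus)) => -[r]; exists r, i.
Qed.

Lemma occurs_tImp x t u : occurs x t \/ occurs x u -> occurs x (tImp t u).
Proof.
by case=> [/(occurs_signed Minus)|] [r]; exists r; [left | right].
Qed.

End Syntax.

(** * Interpretation of the connectives and monotonicity of evaluation *)

Definition sle {d : Order.disp_t} {A : tbDistrLatticeType d} (s : sign)
    (a b : A) : bool :=
  if s is Plus then a <= b else b <= a.

Section Evaluation.
Context {L : logic} {sg : signature} {d : Order.disp_t}.
Context {A : tbDistrLatticeType d} (X : algebra L sg A).
Hypothesis PX : perfect X.
Implicit Types (a b c : A) (e : atom -> A) (s : sign) (t : term sg).

Let PA : perfect_lattice A := perfectL PX.
Let f := op_f (dlr_of X).
Let g := op_g (dlr_of X).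
Let k := op_k (dlr_of X).
Let l := op_l (dlr_of X).

Lemma preserves_sups_f : preserves_sups (eta_f sg) One f.
Proof. exact: perfect_f PX. Qed.

(** The meets preserved by [g] are joins once source and target are dualized, so [g] falls under the
    same results as [f]. *)
Lemma preserves_sups_g : preserves_sups (dualo (eta_g sg)) Dual g.
Proof. by move=> S u S0; rewrite osups_dual; exact: perfect_g PX _ _ S0. Qed.

Lemma preserves_sups_k x i :
  preserves_sups (eps_k i) One (fun a => k (upd x i a)).
Proof. exact: perfect_k PX x i. Qed.

Lemma preserves_sups_l x i :
  preserves_sups (dualo (eps_l i)) Dual (fun a => l (upd x i a)).
Proof. by move=> S u S0; rewrite osups_dual; exact: perfect_l PX x i _ _ S0. Qed.

(** [D] is [diamond_f] or [lhd_f], depending on [eta_f]. [adjoint_exists] shows that the set from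
    which [adj_f] is chosen is inhabited, so the chosen element has the adjunction property. *)
Lemma adj_f_spec : exists D : A -> A,
  (forall u v, D u <= v <-> ole (eta_f sg) u (adj_f X v)) /\
  (forall a b, f a <= b <-> f (obot (eta_f sg)) <= b /\ D a <= b).
Proof.
have := preserves_sups_f; rewrite /adj_f; case: (eta_f sg) => fP.
- exists (diamond_f X); split=> [u v|a b].
    apply: (xgetPex \bot
      (P := [set w | forall u, diamond_f X u <= v <-> u <= w])).
    exact: (adjoint_exists (o1 := One) (o2 := One) (h := f) (D := diamond_f X)
      PA (fun u => osupP PA One _)).
  exact: (op_le_split PA fP (fun u => osupP PA One _)).
- exists (lhd_f X); split=> [u v|a b].
    apply: (xgetPex \bot (P := [set w | forall u, lhd_f X u <= v <-> w <= u])).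
    exact: (adjoint_exists (o1 := Dual) (o2 := One) (h := f) (D := lhd_f X)
      PA (fun u => osupP PA One _)).
  exact: (op_le_split PA fP (fun u => osupP PA One _)).
Qed.

Lemma adj_g_spec : exists D : A -> A,
  (forall u v, v <= D u <-> ole (eta_g sg) (adj_g X v) u) /\
  (forall a b, b <= g a <-> b <= g (obot (dualo (eta_g sg))) /\ b <= D a).
Proof.
have := preserves_sups_g; rewrite /adj_g; case: (eta_g sg) => gP.
- exists (box_g X); split=> [u v|a b].
    apply: iff_sym.
    apply: (xgetPex \bot (P := [set w | forall u, w <= u <-> v <= box_g X u])).
    have [w wP] := adjoint_exists (o1 := Dual) (o2 := Dual)
      (h := g) (D := box_g X) PA (fun u => osupP PA Dual _) v.
    by exists w => t; apply: iff_sym; exact: wP.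
  exact: (op_le_split PA gP (fun u => osupP PA Dual _)).
- exists (rhd_g X); split=> [u v|a b].
    apply: (xgetPex \bot (P := [set w | forall u, v <= rhd_g X u <-> u <= w])).
    exact: (adjoint_exists (o1 := One) (o2 := Dual) (h := g) (D := rhd_g X)
      PA (fun u => osupP PA Dual _)).
  exact: (op_le_split PA gP (fun u => osupP PA Dual _)).
Qed.

Lemma f_le_adj a b :
  f a <= b <-> f (obot (eta_f sg)) <= b /\ ole (eta_f sg) a (adj_f X b).
Proof. by have [D [DP ->]] := adj_f_spec; rewrite DP. Qed.

Lemma le_g_adj a b :
  b <= g a <->
  b <= g (obot (dualo (eta_g sg))) /\ ole (eta_g sg) (adj_g X b) a.
Proof. by have [D [DP ->]] := adj_g_spec; rewrite DP. Qed.

Lemma adj_f_homo a b : ole (eta_f sg) a b -> adj_f X a <= adj_f X b.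
Proof.
have [D [DP _]] := adj_f_spec; move: DP; case: (eta_f sg) => /= DP ab.
- by apply/DP; apply: le_trans ab; apply/DP.
- by apply/DP; apply: le_trans ab; apply/DP.
Qed.

Lemma adj_g_homo a b : ole (eta_g sg) a b -> adj_g X a <= adj_g X b.
Proof.
have [D [DP _]] := adj_g_spec; move: DP; case: (eta_g sg) => /= DP ab.
- by apply/DP; apply: le_trans ab _; apply/DP.
- by apply/DP; apply: le_trans ab _; apply/DP.
Qed.

Lemma le_imp a b c : c <= imp X a b <-> a `&` c <= b.
Proof.
rewrite /imp; case: L X => Y; last by rewrite op_impP.
apply: (xgetPex \bot (P := [set c | forall x, x <= c <-> a `&` x <= b])).
exact: (residual_exists PA One).
Qed.

Lemma sub_le a b c : sub a b <= c <-> a <= b `|` c.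
Proof.
apply: (xgetPex \bot (P := [set c | forall x, c <= x <-> a <= b `|` x])).
exact: (residual_exists PA Dual).
Qed.

Lemma imp_homo a a' b b' : a' <= a -> b <= b' -> imp X a b <= imp X a' b'.
Proof.
move=> aa bb; apply/le_imp; apply: le_trans bb.
by apply: le_trans (leI2 aa (lexx _)) _; apply/le_imp.
Qed.

Lemma sub_homo a a' b b' : a <= a' -> b' <= b -> sub a b <= sub a' b'.
Proof.
move=> aa bb; apply/sub_le; apply: le_trans aa _.
by apply: le_trans (leU2 bb (lexx _)); apply/sub_le.
Qed.

Lemma f_homo a b : ole (eta_f sg) a b -> f a <= f b.
Proof. by move/(preserves_sups_homo preserves_sups_f). Qed.

Lemma g_homo a b : ole (eta_g sg) a b -> g a <= g b.
Proof. by rewrite -ole_dual => /(preserves_sups_homo preserves_sups_g). Qed.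

Lemma k_homo x y : (forall i, ole (eps_k i) (x i) (y i)) -> k x <= k y.
Proof. by move/(coordinatewise_homo preserves_sups_k). Qed.

Lemma l_homo x y : (forall i, ole (eps_l i) (x i) (y i)) -> l x <= l y.
Proof.
move=> xy; apply: (coordinatewise_homo preserves_sups_l) => i.
by rewrite ole_dual.
Qed.

Lemma sle_child o s a b :
  sle (child_sign o s) a b = if s is Plus then ole o a b else ole o b a.
Proof. by case: o; case: s. Qed.

(** Every connective, including the residuals and adjoints, is monotone or antitone as [child_sign]
    or [flip] records. Comparing the assignments only at signed leaves yields both dependence on
    occurring atoms alone and monotonicity in a variable of constant sign. *)
Lemma eval_homo e e' t s :
  (forall x r, signed_occ r x s t -> sle r (e x) (e' x)) ->
  sle s (eval X e t) (eval X e' t).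
Proof.
elim: t s => /=.
- by move=> x s; apply.
- by move=> s _; case: s => /=.
- by move=> s _; case: s => /=.
- move=> a IHa b IHb s ee.
  have := IHa s (fun x r h => ee x r (or_introl h)).
  have := IHb s (fun x r h => ee x r (or_intror h)).
  by case: s {ee} => /= hb ha; exact: leI2.
- move=> a IHa b IHb s ee.
  have := IHa s (fun x r h => ee x r (or_introl h)).
  have := IHb s (fun x r h => ee x r (or_intror h)).
  by case: s {ee} => /= hb ha; exact: leU2.
- by move=> a IHa s /IHa; rewrite sle_child; case: s => /= /f_homo.
- by move=> a IHa s /IHa; rewrite sle_child; case: s => /= /g_homo.
- move=> ts IH s ee.
  have {IH ee} : forall i,
      sle (child_sign (eps_k i) s) (eval X e (ts i)) (eval X e' (ts i)).
    by move=> i; apply: IH => x r h; apply: ee; exists i.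
  by case: s => H; apply: k_homo => i; have := H i; rewrite sle_child.
- move=> ts IH s ee.
  have {IH ee} : forall i,
      sle (child_sign (eps_l i) s) (eval X e (ts i)) (eval X e' (ts i)).
    by move=> i; apply: IH => x r h; apply: ee; exists i.
  by case: s => H; apply: l_homo => i; have := H i; rewrite sle_child.
- move=> a IHa b IHb s ee.
  have := IHa (flip s) (fun x r h => ee x r (or_introl h)).
  have := IHb s (fun x r h => ee x r (or_intror h)).
  by case: s {ee} => /= hb ha; exact: imp_homo.
- move=> a IHa b IHb s ee.
  have := IHa s (fun x r h => ee x r (or_introl h)).
  have := IHb (flip s) (fun x r h => ee x r (or_intror h)).
  by case: s {ee} => /= hb ha; exact: sub_homo.
- by move=> a IHa s /IHa; rewrite sle_child; case: s => /= /adj_f_homo.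
- by move=> a IHa s /IHa; rewrite sle_child; case: s => /= /adj_g_homo.
Qed.

Lemma sle_refl s a : sle s a a.
Proof. by case: s => /=. Qed.

Lemma eval_agree e e' t :
  (forall x, occurs x t -> e x = e' x) -> eval X e t = eval X e' t.
Proof.
move=> ee; have sE r x : signed_occ r x Plus t -> e x = e' x.
  by move=> h; apply: ee; exists r.
apply/le_anti/andP; split; apply: (eval_homo (s := Plus)) => x r /sE ->;
  exact: sle_refl.
Qed.

(** * Updated assignments and substitution *)

Definition upd_atom e (x : atom) a : atom -> A :=
  fun y => if pselect (y = x) then a else e y.

Lemma upd_atomE e x a : upd_atom e x a x = a.
Proof. by rewrite /upd_atom; case: pselect. Qed.

Lemma upd_atom_neq e x a y : y <> x -> upd_atom e x a y = e y.
Proof. by rewrite /upd_atom; case: pselect. Qed.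

Lemma eval_upd_notin e x a t :
  ~ occurs x t -> eval X (upd_atom e x a) t = eval X e t.
Proof.
move=> xt; apply: eval_agree => y yt.
by rewrite upd_atom_neq // => yx; apply: xt; rewrite -yx.
Qed.

Lemma eval_subst e p u t :
  eval X e (subst p u t) = eval X (upd_atom e (PVar p) (eval X e u)) t.
Proof.
elim: t => //=; try by move=> a ->.
- case=> [q|i|m] /=.
  + by case: eqP => [->|qp]; rewrite ?upd_atomE // upd_atom_neq // => -[].
  + by rewrite upd_atom_neq.
  + by rewrite upd_atom_neq.
- by move=> a -> b ->.
- by move=> a -> b ->.
- by move=> ts IH; congr (op_k _ _); apply/funext.
- by move=> ts IH; congr (op_l _ _); apply/funext.
- by move=> a -> b ->.
- by move=> a -> b ->.
Qed.

Lemma eval_positive e p a b t :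
  positive p t -> a <= b ->
  eval X (upd_atom e (PVar p) a) t <= eval X (upd_atom e (PVar p) b) t.
Proof.
move=> pt ab; apply: (eval_homo (s := Plus)) => x r.
have [->|xp] := pselect (x = PVar p); last by rewrite !upd_atom_neq // sle_refl.
by rewrite !upd_atomE; case: r => // /pt.
Qed.

Lemma eval_negative e p a b t :
  negative p t -> a <= b ->
  eval X (upd_atom e (PVar p) b) t <= eval X (upd_atom e (PVar p) a) t.
Proof.
move=> pt ab; apply: (eval_homo (s := Plus)) => x r.
have [->|xp] := pselect (x = PVar p); last by rewrite !upd_atom_neq // sle_refl.
by rewrite !upd_atomE; case: r => // /pt.
Qed.

Lemma eval_bigOr e us a :
  eval X e (bigOr us) <= a <-> forall u, List.In u us -> eval X e u <= a.
Proof.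
elim: us => [|u us IH]; first by rewrite /= le0x.
have -> : eval X e (bigOr (u :: us)) = eval X e u `|` eval X e (bigOr us).
  by case: us {IH} => //=; rewrite joinx0.
rewrite leUx; split=> [/andP[ua /IH usa] v /= [<-//|/usa]//|H].
by apply/andP; split; [apply: H; left | apply/IH => v v_us; apply: H; right].
Qed.

Lemma eval_bigAnd e us a :
  a <= eval X e (bigAnd us) <-> forall u, List.In u us -> a <= eval X e u.
Proof.
elim: us => [|u us IH]; first by rewrite /= lex1.
have -> : eval X e (bigAnd (u :: us)) = eval X e u `&` eval X e (bigAnd us).
  by case: us {IH} => //=; rewrite meetx1.
rewrite lexI; split=> [/andP[ua /IH usa] v /= [<-//|/usa]//|H].
by apply/andP; split; [apply: H; left | apply/IH => v v_us; apply: H; right].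
Qed.

Lemma upd_atom_id e x : upd_atom e x (e x) = e.
Proof. by apply/funext => y; have [->|yx] := pselect (y = x);
  [exact: upd_atomE | exact: upd_atom_neq]. Qed.

(** * Preprocessing and first approximation *)

Definition holds_all e (S : system sg) : Prop :=
  forall I, List.In I S -> holds X e I.

Lemma eval_upd e n (ts : 'I_n -> term sg) i t :
  (fun j => eval X e (upd ts i t j)) =
  upd (fun j => eval X e (ts j)) i (eval X e t).
Proof. by apply/funext => j; rewrite /upd; case: ifP. Qed.

(** Each distribution is an equation, from lattice distributivity or from preservation of binary
    joins or meets in one coordinate, and hence can be performed at any depth. *)
Lemma eval_push e s t t' : push s t t' -> eval X e t = eval X e t'.
Proof.
elim=> {s t t'} /=.
- by move=> a b c; rewrite meetUl.
- by move=> a b c; rewrite meetUr.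
- move=> a b E.
  by have := op_f_join (dlr_of X) (eval X e a) (eval X e b); rewrite E.
- move=> a b E.
  by have := op_g_meet (dlr_of X) (eval X e a) (eval X e b); rewrite E.
(* Writing [ts] as its own update at [i] puts the term in the form in which [op_k_join] is
   stated. *)
- move=> ts i a b E tsi; rewrite -{1}(upd_id ts i) tsi !eval_upd /=.
  by rewrite -op_k_join E.
- move=> ts i a b E tsi; rewrite -{1}(upd_id ts i) tsi !eval_upd /=.
  by rewrite -op_l_meet E.
- by move=> a b c; rewrite joinIl.
- by move=> a b c; rewrite joinIr.
- move=> a b E.
  by have := op_g_meet (dlr_of X) (eval X e a) (eval X e b); rewrite E.
- move=> a b E.
  by have := op_f_join (dlr_of X) (eval X e a) (eval X e b); rewrite E.
- move=> ts i a b E tsi; rewrite -{1}(upd_id ts i) tsi !eval_upd /=.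
  by rewrite -op_k_join E.
- move=> ts i a b E tsi; rewrite -{1}(upd_id ts i) tsi !eval_upd /=.
  by rewrite -op_l_meet E.
- by move=> s a a' b _ ->.
- by move=> s a a' b _ ->.
- by move=> s a a' b _ ->.
- by move=> s a a' b _ ->.
- by move=> s a a' _ ->.
- by move=> s a a' _ ->.
- by move=> s ts i a' _ E; rewrite -{1}(upd_id ts i) !eval_upd E.
- by move=> s ts i a' _ E; rewrite -{1}(upd_id ts i) !eval_upd E.
- by move=> s a a' b _ ->.
- by move=> s a a' b _ ->.
Qed.

Lemma splitting_holds e I new :
  splitting I new -> (holds X e I <-> holds_all e new).
Proof.
case=> a b c; rewrite /holds /= ?lexI ?leUx.
  by split=> [/andP[ab ac] J /= [<-|[<-|]]//|H]; apply/andP; split;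
    [apply: (H (a, b)) | apply: (H (a, c))]; rewrite /=; tauto.
by split=> [/andP[ab ac] J /= [<-|[<-|]]//|H]; apply/andP; split;
  [apply: (H (a, c)) | apply: (H (b, c))]; rewrite /=; tauto.
Qed.

Lemma assignment_upd_var e p a :
  assignment e -> assignment (upd_atom e (PVar p) a).
Proof. by move=> eA n; rewrite !upd_atom_neq. Qed.

(** Pushing and splitting are equivalences under each assignment. Variable elimination needs all
    assignments: the extremal instance implies the others by [a(p) <= a(bot) <= b(bot) <= b(p)], and
    similarly with top. *)
Lemma preprocess_rule_valid I new : preprocess_rule I new ->
  (valid X I <-> forall J, List.In J new -> valid X J).
Proof.
case=> {I new}.
- move=> a a' b aa'; split=> [v J /= [<-|//] e /v|/(_ _ (or_introl erefl)) v e /v];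
    by rewrite /holds /= (eval_push _ aa').
- move=> a b b' bb'; split=> [v J /= [<-|//] e /v|/(_ _ (or_introl erefl)) v e /v];
    by rewrite /holds /= (eval_push _ bb').
- move=> I new In; split=> [v J Jnew e eA|v e eA].
    by have /(splitting_holds _ In) := v e eA; apply.
  by apply/(splitting_holds _ In) => J Jnew; exact: v.
- move=> p a b _ na pb; split=> [v J /= [<-|//] e eA|/(_ _ (or_introl erefl)) v e eA].
    by rewrite /holds /= !eval_subst; apply: v; exact: assignment_upd_var.
  have := v e eA; rewrite /holds /= !eval_subst /= -{4}(upd_atom_id e (PVar p)).
  rewrite -{3}(upd_atom_id e (PVar p)) => ab.
  apply: le_trans (eval_negative _ na (le0x _)) _.
  exact: le_trans ab (eval_positive _ pb (le0x _)).
- move=> p a b _ pb na; split=> [v J /= [<-|//] e eA|/(_ _ (or_introl erefl)) v e eA].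
    by rewrite /holds /= !eval_subst; apply: v; exact: assignment_upd_var.
  have := v e eA; rewrite /holds /= !eval_subst /= -{4}(upd_atom_id e (PVar p)).
  rewrite -{3}(upd_atom_id e (PVar p)) => ab.
  apply: le_trans (eval_positive _ pb (lex1 _)) _.
  exact: le_trans ab (eval_negative _ na (lex1 _)).
Qed.

Lemma preprocess_steps_valid S T :
  Relation_Operators.clos_refl_trans _ preprocess_step S T ->
  ((forall J, List.In J S -> valid X J) <-> (forall J, List.In J T -> valid X J)).
Proof.
elim=> {S T} [S T [I [new [/preprocess_rule_valid IP [R SR [_ ->]]]]]|//|S T U _ -> _ //].
split=> H J.
  move/In_cat => [Jn|JR]; last by apply: H; apply/SR; right.
  by move: J Jn; apply/IP; apply: H; apply/SR; left.
move/SR => [<-|JR]; last by apply: H; apply/In_cat; right.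
by apply/IP => K Kn; apply: H; apply/In_cat; left.
Qed.

(** By join- and meet-generation, an inequality holds once every join-irreducible below its left
    side is below every meet-irreducible above its right side. *)
Lemma first_approx_valid I : Lterm L I.1 -> Lterm L I.2 ->
  (valid X I <-> valid_quasi X (Quasi (first_approx I) (tNom 0, tCon 0))).
Proof.
move=> L1 L2; split=> [v e eA H|v e eA].
  apply: le_trans (H _ (or_introl erefl)) _.
  exact: le_trans (v e eA) (H _ (or_intror (or_introl erefl))).
apply: (ole_gen (o := One) PA) => j Jj /= jI.
apply: (ole_gen (o := Dual) PA) => m Mm /= Im.
pose e' := upd_atom (upd_atom e (Nominal 0) j) (Conominal 0) m.
have ee' t : Lterm L t -> eval X e' t = eval X e t.
  by move=> Lt; rewrite !eval_upd_notin // => /(Lterm_occurs Lt)[].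
have := v e'; rewrite /holds /= /e' upd_atomE upd_atom_neq // upd_atomE; apply.
  move=> [|n]; split; rewrite ?upd_atomE ?(upd_atom_neq _ _ (x := Conominal 0)) //.
  - by rewrite upd_atomE.
  - by rewrite upd_atom_neq//; apply eA.
  - by rewrite upd_atom_neq//; apply eA.
move=> J /= [<-|[<-|//]]; rewrite /holds /= -/e' ee' // /e'.
  by rewrite upd_atom_neq // upd_atomE.
by rewrite upd_atomE.
Qed.

(** * Reduction rules acting on a single inequality *)

Definition atom_of (o : otype) (n : nat) : atom :=
  if o is One then Nominal n else Conominal n.

Lemma assignmentE e : assignment e <-> forall o n, gen o (e (atom_of o n)).
Proof.
split=> [eA o n|eA n]; first by case: o; apply eA.
by split; [exact: (eA One) | exact: (eA Dual)].
Qed.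

Lemma assignment_upd e o n a :
  assignment e -> gen o a -> assignment (upd_atom e (atom_of o n) a).
Proof.
move/assignmentE => eA Ga; apply/assignmentE => o' n'.
have [E|ne] := pselect (atom_of o' n' = atom_of o n); last by rewrite upd_atom_neq.
by rewrite E upd_atomE; case: o o' E Ga => -[].
Qed.

(** The assignment stays fixed: residuation and adjunction are equivalences, and the approximation
    rules are reversed by monotonicity of the operations. *)
Lemma reduce_rule_sound S I alts alt e :
  reduce_rule L S I alts -> List.In alt alts -> holds_all e alt -> holds X e I.
Proof.
have H1 (J : ineq sg) K : holds_all e (J :: K) -> holds X e J by apply; left.
have H2 (J1 J : ineq sg) K : holds_all e (J1 :: J :: K) -> holds X e J.
  by apply; right; left.
have H3 (J1 J2 J : ineq sg) K : holds_all e (J1 :: J2 :: J :: K) -> holds X e J.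
  by apply; right; right; left.
case=> {I alts}.
- by move=> I new In /= [<-|//]; move/(splitting_holds e In).
- by move=> a b c /= [<-|//] /H1; rewrite /holds /= => /le_imp.
- by move=> a b c _ /= [<-|//] /H1; rewrite /holds /= => ?; apply/le_imp.
- by move=> a b c /= [<-|//] /H1; rewrite /holds /= => /sub_le; rewrite joinC.
- move=> a b E /= [<-|//] H; apply/f_le_adj; rewrite E.
  by split; [exact: (H1 _ _ H) | exact: (H2 _ _ _ H)].
- move=> a b E /= [<-|//] H; apply/f_le_adj; rewrite E.
  by split; [exact: (H1 _ _ H) | exact: (H2 _ _ _ H)].
- move=> a b E /= [<-|//] H; apply/le_g_adj; rewrite E.
  by split; [exact: (H1 _ _ H) | exact: (H2 _ _ _ H)].
- move=> a b E /= [<-|//] H; apply/le_g_adj; rewrite E.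
  by split; [exact: (H1 _ _ H) | exact: (H2 _ _ _ H)].
- move=> i j a E _ /= [<-|[<-|//]] H.
    by apply: le_trans (H1 _ _ H) _; apply: f_homo; rewrite E; exact: le0x.
  by apply: le_trans (H2 _ _ _ H) _; apply: f_homo; rewrite E; exact: H1 H.
- move=> i m a E _ /= [<-|[<-|//]] H.
    by apply: le_trans (H1 _ _ H) _; apply: f_homo; rewrite E; exact: lex1.
  by apply: le_trans (H2 _ _ _ H) _; apply: f_homo; rewrite E; exact: H1 H.
- move=> m n a E _ /= [<-|[<-|//]] H.
    by apply: le_trans (H1 _ _ H); apply: g_homo; rewrite E; exact: lex1.
  by apply: le_trans (H2 _ _ _ H); apply: g_homo; rewrite E; exact: H1 H.
- move=> m i a E _ /= [<-|[<-|//]] H.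
    by apply: le_trans (H1 _ _ H); apply: g_homo; rewrite E; exact: le0x.
  by apply: le_trans (H2 _ _ _ H); apply: g_homo; rewrite E; exact: H1 H.
- move=> i ts js ms _ _ _ _ /In_map[Y _ <-] H.
  apply: le_trans (H1 _ _ H) _; apply: k_homo => c /=.
  have Hc : c \in Y -> holds X e (match eps_k c with
      One => (tNom (js c), ts c) | Dual => (ts c, tCon (ms c)) end).
    by move=> cY; apply: H; right; apply/In_map; exists c => //;
      apply/In_mem; rewrite mem_enum.
  by case: (eps_k c) Hc => Hc; case: ifP => [/Hc //|_]; rewrite /= ?le0x ?lex1.
- move=> m ts ns js _ _ _ _ /In_map[Y _ <-] H.
  apply: le_trans (H1 _ _ H); apply: l_homo => c /=.
  have Hc : c \in Y -> holds X e (match eps_l c with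
      One => (ts c, tCon (ns c)) | Dual => (tNom (js c), ts c) end).
    by move=> cY; apply: H; right; apply/In_map; exists c => //;
      apply/In_mem; rewrite mem_enum.
  by case: (eps_l c) Hc => Hc; case: ifP => [/Hc //|_]; rewrite /= ?le0x ?lex1.
- move=> a b m j n _ _ _ /= [<-|//] H.
  by apply: le_trans (H3 _ _ _ _ H); apply: imp_homo; [exact: H1 H | exact: H2 H].
Qed.

(** Only fresh atoms may change value. Since [Nominal 0] and [Conominal 0] are never fresh, the
    conclusion keeps its value along with all members of [S]. *)
Definition agree_on (S : system sg) e e' : Prop :=
  forall x, ~ fresh S x -> e' x = e x.

Lemma agree_on_upd S e e' x a :
  fresh S x -> agree_on S e e' -> agree_on S e (upd_atom e' x a).
Proof.
by move=> xF ee y yF; rewrite upd_atom_neq ?ee // => yx; apply: yF; rewrite yx.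
Qed.

Lemma agree_on_eval S e e' (J : ineq sg) t : agree_on S e e' -> List.In J S ->
  (forall x, occurs x t -> occurs_ineq x J) -> eval X e' t = eval X e t.
Proof.
by move=> ee JS tJ; apply: eval_agree => x /tJ xJ; apply: ee => -[_ _ /(_ _ JS)].
Qed.

Lemma agree_on_holds S e e' (J : ineq sg) :
  agree_on S e e' -> List.In J S -> holds X e J -> holds X e' J.
Proof.
move=> ee JS; rewrite /holds.
by rewrite !(agree_on_eval ee JS) // => x; [right | left].
Qed.

Lemma fresh_neq S x y (J : ineq sg) :
  fresh S x -> List.In J S -> occurs_ineq y J -> y <> x.
Proof. by move=> [_ _ xS] JS yJ yx; apply: (xS J JS); rewrite -yx. Qed.

Lemma occurs_atom x : occurs (sg := sg) x (tAtom x).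
Proof. by exists Plus. Qed.

(** Names the witnesses of all coordinates in [Y] at once; for injective [v] the coordinate picked
    is unique. *)
Definition upd_atoms n (v : 'I_n -> atom) (Y : {set 'I_n}) e (a : 'I_n -> A) :
    atom -> A :=
  fun y => if [pick i in Y | `[< v i = y >]] is Some i then a i else e y.

Lemma upd_atomsE n (v : 'I_n -> atom) (Y : {set 'I_n}) e (a : 'I_n -> A) i :
  injective v -> i \in Y -> upd_atoms v Y e a (v i) = a i.
Proof.
move=> vI iY; rewrite /upd_atoms.
case: pickP => [j /andP[_ /asboolP/vI -> //]|/(_ i)].
by rewrite iY /= asboolT.
Qed.

Lemma upd_atoms_neq n (v : 'I_n -> atom) (Y : {set 'I_n}) e (a : 'I_n -> A) y :
  (forall i, v i <> y) -> upd_atoms v Y e a y = e y.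
Proof.
by move=> vy; rewrite /upd_atoms; case: pickP => // j /andP[_ /asboolP/vy].
Qed.

Lemma assignment_upds n (o : 'I_n -> otype) (r : 'I_n -> nat) (Y : {set 'I_n})
    e (a : 'I_n -> A) :
  assignment e -> (forall i, i \in Y -> gen (o i) (a i)) ->
  assignment (upd_atoms (fun i => atom_of (o i) (r i)) Y e a).
Proof.
move=> /assignmentE eA Ga; apply/assignmentE => o' n'; rewrite /upd_atoms.
case: pickP => [i /andP[iY /asboolP E]|_]; last exact: eA.
by have := Ga i iY; case: o' (o i) E => -[].
Qed.

Lemma agree_on_upds S e n (v : 'I_n -> atom) (Y : {set 'I_n}) (a : 'I_n -> A) :
  (forall i, fresh S (v i)) -> agree_on S e (upd_atoms v Y e a).
Proof.
move=> vF x xF; apply: upd_atoms_neq => i vx; apply: xF; rewrite -vx; exact: vF.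
Qed.

(* The witnesses provided by join- and meet-primeness are named by the fresh
   nominals and conominals. *)
Lemma reduce_rule_complete S I alts e :
  reduce_rule L S I alts -> List.In I S -> assignment e -> holds X e I ->
  exists e' alt, [/\ assignment e', agree_on S e e', List.In alt alts
                   & holds_all e' alt].
Proof.
move=> RI IS eA; case: RI IS => {I alts}.
- move=> I new In IS eI; exists e, new; split=> //; first by left.
  by apply/(splitting_holds e In).
- move=> a b c IS; rewrite /holds /= => eI; exists e, [:: (b, tImp a c)].
  by split=> //; [left|move=> J /= [<-|//]; apply/le_imp].
- move=> a b c _ IS; rewrite /holds /= => /le_imp eI; exists e, [:: (tAnd a b, c)].
  by split=> //; [left|move=> J /= [<-|//]].
- move=> a b c IS; rewrite /holds /= joinC => /sub_le eI.
  by exists e, [:: (tSub a c, b)]; split=> //; [left|move=> J /= [<-|//]].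
- move=> a b E IS /f_le_adj; rewrite E => -[h1 h2].
  by eexists e, _; split=> //; [left; reflexivity|move=> J /= [<-|[<-|//]]].
- move=> a b E IS /f_le_adj; rewrite E => -[h1 h2].
  by eexists e, _; split=> //; [left; reflexivity|move=> J /= [<-|[<-|//]]].
- move=> a b E IS /le_g_adj; rewrite E => -[h1 h2].
  by eexists e, _; split=> //; [left; reflexivity|move=> J /= [<-|[<-|//]]].
- move=> a b E IS /le_g_adj; rewrite E => -[h1 h2].
  by eexists e, _; split=> //; [left; reflexivity|move=> J /= [<-|[<-|//]]].
- move=> i j a E xF IS eI.
  have xi : Nominal i <> Nominal j.
    by apply: fresh_neq xF IS _; left; exact: occurs_atom.
  have Gi : gen One (e (Nominal i)) by apply eA.
  have := gen_le_op PA preserves_sups_f Gi eI; rewrite E => -[h|[c [Gc ca ic]]].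
    by eexists e, _; split=> //; [left; reflexivity|move=> J /= [<-|//]].
  have ee : agree_on S e (upd_atom e (Nominal j) c) by exact: agree_on_upd.
  eexists (upd_atom e (Nominal j) c), _; split=> //.
  + exact: (assignment_upd (o := One)).
  + by right; left; reflexivity.
  + move=> J /= [<-|[<-|//]]; rewrite /holds /= upd_atomE ?upd_atom_neq //.
    by rewrite (agree_on_eval ee IS) // => x /occurs_tF; right.
- move=> i m a E xF IS eI.
  have xi : Nominal i <> Conominal m.
    by apply: fresh_neq xF IS _; left; exact: occurs_atom.
  have Gi : gen One (e (Nominal i)) by apply eA.
  have := gen_le_op PA preserves_sups_f Gi eI; rewrite E => -[h|[c [Gc ca ic]]].
    by eexists e, _; split=> //; [left; reflexivity|move=> J /= [<-|//]].
  have ee : agree_on S e (upd_atom e (Conominal m) c) by exact: agree_on_upd.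
  eexists (upd_atom e (Conominal m) c), _; split=> //.
  + exact: (assignment_upd (o := Dual)).
  + by right; left; reflexivity.
  + move=> J /= [<-|[<-|//]]; rewrite /holds /= upd_atomE ?upd_atom_neq //.
    by rewrite (agree_on_eval ee IS) // => x /occurs_tF; right.
- move=> m n a E xF IS eI.
  have xi : Conominal m <> Conominal n.
    by apply: fresh_neq xF IS _; right; exact: occurs_atom.
  have Gi : gen Dual (e (Conominal m)) by apply eA.
  have := gen_le_op PA preserves_sups_g Gi eI; rewrite E => -[h|[c [Gc ca ic]]].
    by eexists e, _; split=> //; [left; reflexivity|move=> J /= [<-|//]].
  have ee : agree_on S e (upd_atom e (Conominal n) c) by exact: agree_on_upd.
  eexists (upd_atom e (Conominal n) c), _; split=> //.
  + exact: (assignment_upd (o := Dual)).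
  + by right; left; reflexivity.
  + move=> J /= [<-|[<-|//]]; rewrite /holds /= upd_atomE ?upd_atom_neq //.
    by rewrite (agree_on_eval ee IS) // => x /occurs_tG; left.
- move=> m i a E xF IS eI.
  have xi : Conominal m <> Nominal i.
    by apply: fresh_neq xF IS _; right; exact: occurs_atom.
  have Gi : gen Dual (e (Conominal m)) by apply eA.
  have := gen_le_op PA preserves_sups_g Gi eI; rewrite E => -[h|[c [Gc ca ic]]].
    by eexists e, _; split=> //; [left; reflexivity|move=> J /= [<-|//]].
  have ee : agree_on S e (upd_atom e (Nominal i) c) by exact: agree_on_upd.
  eexists (upd_atom e (Nominal i) c), _; split=> //.
  + exact: (assignment_upd (o := One)).
  + by right; left; reflexivity.
  + move=> J /= [<-|[<-|//]]; rewrite /holds /= upd_atomE ?upd_atom_neq //.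
    by rewrite (agree_on_eval ee IS) // => x /occurs_tG; left.
- move=> i ts js ms jsI jsF msI msF IS eI.
  (* Nominals name the witnesses at coordinates of order type 1, conominals those at dual
     coordinates. *)
  pose v (c : 'I_(ar_k sg)) :=
    atom_of (eps_k c) (if eps_k c is One then js c else ms c).
  have vF (c : 'I_(ar_k sg)) : fresh S (v c) by rewrite /v; case: (eps_k c).
  have vI : injective v.
    by move=> c c'; rewrite /v; case: (eps_k c); case: (eps_k c') => // -[];
      first [exact: jsI | exact: msI].
  have iv (c : 'I_(ar_k sg)) : v c <> Nominal i.
    by move=> vi; apply: (fresh_neq (vF c) IS _ (esym vi)); left; exact: occurs_atom.
  have Gi : gen One (e (Nominal i)) by apply eA.
  have [Y [a [Ya ia]]] := gen_le_coordinatewise PA preserves_sups_k Gi eI.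
  have ee : agree_on S e (upd_atoms v Y e a) by exact: agree_on_upds.
  exists (upd_atoms v Y e a), (k_alternative i ts js ms Y); split=> //.
  + by apply: assignment_upds => // c cY; have [] := Ya c cY.
  + by apply/In_map; exists Y => //; apply/In_mem; rewrite mem_enum.
  move=> J /= [<-|/In_map[c /In_mem]]; last first.
    rewrite mem_enum => cY; have [_] := Ya c cY; have := upd_atomsE e a vI cY.
    have ts_c : eval X (upd_atoms v Y e a) (ts c) = eval X e (ts c).
      by apply: agree_on_eval ee IS _ => x /occurs_tK; right.
    by rewrite /v; case: (eps_k c) => /= vc ac <-; rewrite /holds /= vc ts_c.
  rewrite /holds /= upd_atoms_neq //; apply: le_trans ia _; apply: k_homo => c.
  case: ifP => cY; last by case: (eps_k c) => /=.
  have := upd_atomsE e a vI cY; rewrite /v.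
  by case: (eps_k c) => /= ->.
- move=> m ts ns js nsI nsF jsI jsF IS eI.
  (* For [l] the roles are exchanged, because its meets are joins in the order dual. *)
  pose v (c : 'I_(ar_l sg)) :=
    atom_of (dualo (eps_l c)) (if eps_l c is One then ns c else js c).
  have vF (c : 'I_(ar_l sg)) : fresh S (v c) by rewrite /v; case: (eps_l c).
  have vI : injective v.
    by move=> c c'; rewrite /v; case: (eps_l c); case: (eps_l c') => // -[];
      first [exact: nsI | exact: jsI].
  have iv (c : 'I_(ar_l sg)) : v c <> Conominal m.
    by move=> vi; apply: (fresh_neq (vF c) IS _ (esym vi)); right; exact: occurs_atom.
  have Gi : gen Dual (e (Conominal m)) by apply eA.
  have [Y [a [Ya ia]]] := gen_le_coordinatewise PA preserves_sups_l Gi eI.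
  have ee : agree_on S e (upd_atoms v Y e a) by exact: agree_on_upds.
  exists (upd_atoms v Y e a), (l_alternative m ts ns js Y); split=> //.
  + by apply: assignment_upds => // c cY; have [] := Ya c cY.
  + by apply/In_map; exists Y => //; apply/In_mem; rewrite mem_enum.
  move=> J /= [<-|/In_map[c /In_mem]]; last first.
    rewrite mem_enum => cY; have [_] := Ya c cY; have := upd_atomsE e a vI cY.
    have ts_c : eval X (upd_atoms v Y e a) (ts c) = eval X e (ts c).
      by apply: agree_on_eval ee IS _ => x /occurs_tL; left.
    by rewrite /v; case: (eps_l c) => /= vc ac <-; rewrite /holds /= vc ts_c.
  rewrite /holds /= upd_atoms_neq //; apply: le_trans ia; apply: l_homo => c.
  case: ifP => cY; last by case: (eps_l c) => /=.
  have := upd_atomsE e a vI cY; rewrite /v.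
  by case: (eps_l c) => /= ->.
- move=> a b m j n _ jF nF IS eI.
  (* The infimum of these implications lies below [a -> b]: residuating back and forth, it suffices
     to test against generators [x] below [a] and [y] above [b]. Meet-primeness of [m] then yields a
     single pair. *)
  pose T := [set imp X x y | x in [set x | Jinf x /\ x <= eval X e a] &
                             y in [set y | Minf y /\ eval X e b <= y]].
  have Mm : gen Dual (e (Conominal m)) by apply eA.
  have infT : osup Dual T <= e (Conominal m).
    apply: le_trans eI; apply/le_imp.
    apply: (ole_gen (o := Dual) PA) => y My bY /=.
    rewrite meetC -le_imp; apply: (ole_gen (o := One) PA) => x Jx xa /=.
    rewrite le_imp meetC -le_imp.
    apply: (osups_ub (o := Dual) (osupP PA _ _)).
    by exists x => //; exists y.
  have [_ [x [Jx xa] [y [My yb] <-]] xym] := gen_prime PA Mm (osupP PA _ _) infT.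
  have mn : Conominal m <> Conominal n.
    by apply: fresh_neq nF IS _; right; exact: occurs_atom.
  pose e' := upd_atom (upd_atom e (Nominal j) x) (Conominal n) y.
  have ee : agree_on S e e' by do 2 apply: agree_on_upd => //.
  have eA' : assignment e'.
    by apply: (assignment_upd (o := Dual)) => //; exact: (assignment_upd (o := One)).
  have [aE bE] : eval X e' a = eval X e a /\ eval X e' b = eval X e b.
    by split; apply: agree_on_eval ee IS _ => z ?; left; apply: occurs_tImp; [left|right].
  eexists e', _; split=> //; first by left; reflexivity.
  have ej : e' (Nominal j) = x by rewrite /e' upd_atom_neq // upd_atomE.
  have en : e' (Conominal n) = y by rewrite /e' upd_atomE.
  have em : e' (Conominal m) = e (Conominal m) by rewrite /e' !upd_atom_neq.
  by move=> J /= [<-|[<-|[<-|//]]]; rewrite /holds /= ?ej ?en ?em ?aE ?bE.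
Qed.

(** * Whole systems, the Ackermann rules and complete reduction runs *)

Definition valid_system (S : system sg) : Prop :=
  valid_quasi X (Quasi S (tNom 0, tCon 0)).

Lemma reduce_system_valid S alts : reduce_system L S alts ->
  (valid_system S <-> forall T, List.In T alts -> valid_system T).
Proof.
case=> {alts} [I alts R SR _ RI|p us R SR usp Rp|p us R SR usp Rp].
- split=> [v _ /In_map[alt alt_in <-] e eA H|v e eA H].
    apply: v => // J /SR[<-|JR]; last by apply: H; apply/In_cat; right.
    by apply: reduce_rule_sound RI alt_in _ => K Kalt; apply: H; apply/In_cat; left.
  have IS : List.In I S by apply/SR; left.
  have [e' [alt [eA' ee alt_in Halt]]] := reduce_rule_complete RI IS eA (H _ IS).
  (* The conclusion is transferred from [e'] back to [e], as the atoms of index 0 are not fresh. *)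
  have := v (alt ++ R) _ e' eA'; rewrite /holds /= !ee; [|by case|by case].
  apply; first by apply/In_map; exists alt.
  move=> J /= /In_cat[/Halt //|JR].
  have JS : List.In J S by apply/SR; right.
  exact: agree_on_holds ee JS (H _ JS).
- set U := bigOr us; split=> [v _ [<-|//] e eA H|/(_ _ (or_introl erefl)) v e eA H].
    (* The minimal value of [p] allowed by its lower bounds, which do not contain [p], recovers the
       original system. *)
    have := v (upd_atom e (PVar p) (eval X e U)) (assignment_upd_var _ _ eA).
    rewrite /holds /= !upd_atom_neq //; apply.
    move=> J /SR/In_cat[/In_map[u u_us <-]|JR].
      rewrite /holds /= upd_atomE eval_upd_notin; last exact: usp.
      by move: u u_us; apply/eval_bigOr.
    have := H (subst_ineq p U J); rewrite /holds /= !eval_subst; apply.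
    by apply/In_map; exists J.
  apply: v => // _ /In_map[J JR <-]; rewrite /holds /= !eval_subst.
  have Up : eval X e U <= e (PVar p).
    apply/eval_bigOr => u u_us; apply: (H (u, tVar p)); apply/SR/In_cat; left.
    by apply/In_map; exists u.
  (* Conversely, from [U <= p] follows the chain [J.1(U) <= J.1(p) <= J.2(p) <= J.2(U)]; the left
     rule uses it with [p <= U] and the opposite signs. *)
  have [p1 p2] := Rp J JR.
  apply: le_trans (eval_positive e p1 Up) _.
  apply: le_trans (eval_negative e p2 Up); rewrite upd_atom_id.
  by apply: (H J); apply/SR/In_cat; right.
- set U := bigAnd us; split=> [v _ [<-|//] e eA H|/(_ _ (or_introl erefl)) v e eA H].
    have := v (upd_atom e (PVar p) (eval X e U)) (assignment_upd_var _ _ eA).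
    rewrite /holds /= !upd_atom_neq //; apply.
    move=> J /SR/In_cat[/In_map[u u_us <-]|JR].
      rewrite /holds /= upd_atomE eval_upd_notin; last exact: usp.
      by move: u u_us; apply/eval_bigAnd.
    have := H (subst_ineq p U J); rewrite /holds /= !eval_subst; apply.
    by apply/In_map; exists J.
  apply: v => // _ /In_map[J JR <-]; rewrite /holds /= !eval_subst.
  have Up : e (PVar p) <= eval X e U.
    apply/eval_bigAnd => u u_us; apply: (H (tVar p, u)); apply/SR/In_cat; left.
    by apply/In_map; exists u.
  have [p1 p2] := Rp J JR.
  apply: le_trans (eval_negative e p1 Up) _.
  apply: le_trans (eval_positive e p2 Up); rewrite upd_atom_id.
  by apply: (H J); apply/SR/In_cat; right.
Qed.

Lemma reduce_steps_valid Ss Ts :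
  Relation_Operators.clos_refl_trans _ (@reduce_step L sg) Ss Ts ->
  ((forall S, List.In S Ss -> valid_system S) <->
   (forall T, List.In T Ts -> valid_system T)).
Proof.
elim=> {Ss Ts} [_ _ [Ss1 S Ss2 alts /reduce_system_valid SP]|//|? ? ? _ -> _ //].
split=> H T.
- move/In_cat => [T1|/In_cat[Ta|T2]]; first by apply: H; apply/In_cat; left.
    move: T Ta; apply/SP; apply: H; apply/In_cat; right; left; reflexivity.
  by apply: H; apply/In_cat; right; right.
- move/In_cat => [T1|[<-|T2]]; first by apply: H; apply/In_cat; left.
    by apply/SP => U Ua; apply: H; apply/In_cat; right; apply/In_cat; left.
  by apply: H; apply/In_cat; right; apply/In_cat; right.
Qed.

End Evaluation.

Theorem theorem6p1 (L : logic) (sg : signature) (phi psi : term sg)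
    (Q : seq (quasi sg)) :
  Lterm L phi -> Lterm L psi ->
  ALBAr L (phi, psi) Q ->
  forall (d : Order.disp_t) (A : tbDistrLatticeType d) (X : algebra L sg A),
    perfect X -> (valid X (phi, psi) <-> valid_all X Q).
Proof.
move=> Lphi Lpsi [Is [finals [[pre _] red _ ->]]] d A X PX.
have LIs : Lsystem (L := L) Is.
  by apply: Lterm_preprocess_steps pre _ => J /= [<-|//].
have preP := preprocess_steps_valid PX pre.
have redP := reduce_steps_valid PX red.
have -> : valid X (phi, psi) <-> forall J, List.In J Is -> valid X J.
  rewrite -preP; split=> [v J /= [<-|//] //|]; apply; by left.
have -> : valid_all X [seq Quasi T (tNom 0, tCon 0) | T <- finals] <->
    forall T, List.In T finals -> valid_system X T.
  split=> [v T TF|v _ /In_map[T TF <-]]; last exact: v.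
  by apply: v; apply/In_map; exists T.
(* Final systems are traded for initial ones, leaving only the first approximation of each
   preprocessed inequality. *)
rewrite -redP; split=> [v _ /In_map[J JI <-]|v J JI].
  have [L1 L2] := LIs J JI.
  by apply/(first_approx_valid PX L1 L2); exact: v.
have [L1 L2] := LIs J JI.
by apply/(first_approx_valid PX L1 L2); apply: v; apply/In_map; exists J.
Qed.
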